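(* Let $A$ be a monoid in $\mathcal{F}$. For all $i,j\in\mathbb{N}$, all $f^i\in\mathcal{H}(A^{\otimes i},A)(x)$ and all $f^j\in\mathcal{H}(A^{\otimes j},A)(y)$, the cup product satisfies $$\beta(f^i\smile f^j)=\beta f^i\smile f^j+(-1)^i f^i\smile\beta f^j .$$ Consequently the cup product induces bilinear maps $\mathcal{H}H^i(A,A)(x)\times\mathcal{H}H^j(A,A)(y)\to\mathcal{H}H^{i+j}(A,A)(x\diamond y)$ which endow $\mathcal{H}H(A)=\bigoplus_{i\in\mathbb{N}}\mathcal{H}H^i(A,A)$ with the structure of an $\mathbb{N}$-graded monoid in $\mathcal{F}$, with identity element $\varepsilon_A\in CA(\mathbf{1})\cong\mathcal{H}H^0(A,A)(\mathbf{1})$.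
   Context: $R$ is a commutative ring with unit and $(\mathcal{X},\diamond,\mathbf{1},\alpha,\lambda,\rho,s)$ is an essentially small symmetric monoidal category enriched in $R$-Mod (so $\diamond$ is $R$-bilinear on morphisms), with $\lambda_x:\mathbf{1}\diamond x\to x$, $\rho_x:x\diamond\mathbf{1}\to x$. $\mathcal{F}$ is the category of $R$-linear functors $\mathcal{X}\to R$-Mod; it is abelian (limits and colimits computed pointwise) and symmetric monoidal closed under Day convolution $\otimes$, with unit $I=\mathcal{X}(\mathbf{1},-)$. A morphism $M_1\otimes\cdots\otimes M_n\to T$ in $\mathcal{F}$ is the same as a family of $R$-multilinear maps $M_1(x_1)\times\cdots\times M_n(x_n)\to T(x_1\diamond\cdots\diamond x_n)$ natural in the $x_i$, and the two are identified. Monoids $A$ in $\mathcal{F}$ are described by bilinear maps $A(x)\times A(y)\to A(x\diamond y)$, $(a,b)\mapsto a\times b$, natural in $x,y$, associative, with identity element $\varepsilon_A\in A(\mathbf{1})$. $s_{u}^{v}:u\to v$ denotes the canonical symmetry isomorphism permuting the factors of $u$ into those of $v$; associativity isomorphisms are suppressed. For $M\in\mathcal{F}$ and $x\in\mathcal{X}$, $M_x:=M(-\diamond x)$. $\mathcal{H}(L,M)\in\mathcal{F}$ is the functor $x\mapsto\mathrm{Hom}_{\mathcal{F}}(L,M_x)$; $A^{\otimes 0}:=I$ and $\mathcal{H}(A^{\otimes 0},A)\cong A$. The Hochschild cochain complex of $A$ with coefficients in $A$ is (isomorphic to) the complex $A\xrightarrow{\beta}\mathcal{H}(A,A)\xrightarrow{\beta}\mathcal{H}(A^{\otimes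 2},A)\to\cdots$ in $\mathcal{F}$, with $A$ in degree $0$, where $\beta_x(m)_y(a)=a\times m-A(s_{x\diamond y}^{y\diamond x})(m\times a)$ for $m\in A(x)$, $a\in A(y)$, and for $n\ge1$, $f\in\mathrm{Hom}_{\mathcal{F}}(A^{\otimes n},A_x)$, $\beta_x(f)$ sends $(a_1,\dots,a_{n+1})\in A(x_1)\times\cdots\times A(x_{n+1})$ to $$a_1\times f(a_2,\dots,a_{n+1})+\sum_{i=1}^n(-1)^i f(a_1,\dots,a_i\times a_{i+1},\dots,a_{n+1})+(-1)^{n+1}A(s_{x_1\diamond\cdots\diamond x_n\diamond x\diamond x_{n+1}}^{x_1\diamond\cdots\diamond x_{n+1}\diamond x})(f(a_1,\dots,a_n)\times a_{n+1}).$$ $\mathcal{H}H^n(A,A)\in\mathcal{F}$ is its $n$-th cohomology. $\mathcal{H}H^0(A,A)$ is identified with the commutant $CA$, $CA(x)=\{m\in A(x)\mid a\times m=A(s_{x\diamond y}^{y\diamond x})(m\times a)\ \forall y\in\mathcal{X},\forall a\in A(y)\}$. Cup product: for $f^i\in\mathrm{Hom}_{\mathcal{F}}(A^{\otimes i},A_x)$ and $f^j\in\mathrm{Hom}_{\mathcal{F}}(A^{\otimes j},A_y)$, $f^i\smile f^j\in\mathrm{Hom}_{\mathcal{F}}(A^{\otimes i+j},A_{x\diamond y})$ sends $(a_1,\dots,a_i,b_1,\dots,b_j)\in A(x_1)\times\cdots\times A(x_i)\times A(y_1)\times\cdots\times A(y_j)$ to $A(\tau)\big(f^i(a_1,\dots,a_i)\times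 f^j(b_1,\dots,b_j)\big)$, where $\tau$ is the symmetry from $x_1\diamond\cdots\diamond x_i\diamond x\diamond y_1\diamond\cdots\diamond y_j\diamond y$ to $x_1\diamond\cdots\diamond x_i\diamond y_1\diamond\cdots\diamond y_j\diamond x\diamond y$. An $\mathbb{N}$-graded monoid in $\mathcal{F}$ is a lax monoidal functor from the discrete monoidal category $(\mathbb{N},+)$ to $\mathcal{F}$; equivalently, a family $F_i\in\mathcal{F}$ $(i\in\mathbb{N})$ with bilinear maps $F_i(x)\times F_j(y)\to F_{i+j}(x\diamond y)$, natural in $x,y$ and associative, and an element $\varepsilon\in F_0(\mathbf{1})$ with $a=F_i(\lambda_x)(\varepsilon\times a)=F_i(\rho_x)(a\times\varepsilon)$ for all $a\in F_i(x)$. *)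

(* Defs.v *)
From HB Require Import structures.
From mathcomp Require Import all_boot all_algebra.
From mathcomp Require Import boolp.

Set Implicit Arguments.
Unset Strict Implicit.
Unset Printing Implicit Defensive.

Import GRing.Theory.
Local Open Scope ring_scope.
Local Open Scope quotient_scope.
#[local] Obligation Tactic := idtac.

Reserved Notation "g ∘ f" (at level 40, left associativity).
Reserved Notation "x ⋄ y" (at level 40, left associativity).
Reserved Notation "f ⋄₁ g" (at level 40, left associativity).
Reserved Notation "f ⌣ g" (at level 40, left associativity).

(* The objects form a type that is small relative to the universe of           *)
(* [lmodType R]: families indexed by all objects again form R-modules. This is *)
(* the role played by essential smallness.                                     *)
Record linCat (R : comPzRingType) := LinCat {
  obj :> Type;
  hom : obj -> obj -> lmodType R;
  idm : forall x, hom x x;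
  comp : forall x y z, hom y z -> hom x y -> hom x z;
  comp_linl : forall x y z (f : hom x y), linear (fun g : hom y z => comp g f);
  comp_linr : forall x y z (g : hom y z), linear (fun f : hom x y => comp g f);
  compA : forall w x y z (h : hom y z) (g : hom x y) (f : hom w x),
    comp h (comp g f) = comp (comp h g) f;
  comp1m : forall x y (f : hom x y), comp (idm y) f = f;
  compm1 : forall x y (f : hom x y), comp f (idm x) = f }.

Arguments hom {R l} x y.
Arguments idm {R l} x.
Arguments comp {R l x y z} g f.
Notation "g ∘ f" := (comp g f).

Record symMonCat (R : comPzRingType) := SymMonCat {
  smcat :> linCat R;
  tens : smcat -> smcat -> smcat;
  tensm : forall x x' y y' : smcat,
    hom x x' -> hom y y' -> hom (tens x y) (tens x' y');
  one : smcat;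
  assoc : forall x y z, hom (tens (tens x y) z) (tens x (tens y z));
  assocV : forall x y z, hom (tens x (tens y z)) (tens (tens x y) z);
  lunit : forall x, hom (tens one x) x;
  lunitV : forall x, hom x (tens one x);
  runit : forall x, hom (tens x one) x;
  runitV : forall x, hom x (tens x one);
  symm : forall x y, hom (tens x y) (tens y x);

  tensm_linl : forall (x x' y y' : smcat) (g : hom y y'),
    linear (fun f : hom x x' => tensm f g);
  tensm_linr : forall (x x' y y' : smcat) (f : hom x x'),
    linear (fun g : hom y y' => tensm f g);
  tensm1 : forall x y, tensm (idm x) (idm y) = idm (tens x y);
  tensmM : forall (x x' x'' y y' y'' : smcat) (f' : hom x' x'') (f : hom x x')
    (g' : hom y' y'') (g : hom y y'),
    tensm (f' ∘ f) (g' ∘ g) = tensm f' g' ∘ tensm f g;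

  assocK : forall x y z, assocV x y z ∘ assoc x y z = idm _;
  assocVK : forall x y z, assoc x y z ∘ assocV x y z = idm _;
  lunitK : forall x, lunitV x ∘ lunit x = idm _;
  lunitVK : forall x, lunit x ∘ lunitV x = idm _;
  runitK : forall x, runitV x ∘ runit x = idm _;
  runitVK : forall x, runit x ∘ runitV x = idm _;
  symmK : forall x y, symm y x ∘ symm x y = idm _;

  assoc_nat : forall (x x' y y' z z' : smcat) (f : hom x x') (g : hom y y')
    (h : hom z z'),
    assoc x' y' z' ∘ tensm (tensm f g) h = tensm f (tensm g h) ∘ assoc x y z;
  lunit_nat : forall (x x' : smcat) (f : hom x x'),
    lunit x' ∘ tensm (idm one) f = f ∘ lunit x;
  runit_nat : forall (x x' : smcat) (f : hom x x'),
    runit x' ∘ tensm f (idm one) = f ∘ runit x;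
  symm_nat : forall (x x' y y' : smcat) (f : hom x x') (g : hom y y'),
    symm x' y' ∘ tensm f g = tensm g f ∘ symm x y;

  pentagon : forall w x y z,
    assoc w x (tens y z) ∘ assoc (tens w x) y z
    = tensm (idm w) (assoc x y z) ∘ assoc w (tens x y) z
      ∘ tensm (assoc w x y) (idm z);
  triangle : forall x y,
    tensm (idm x) (lunit y) ∘ assoc x one y = tensm (runit x) (idm y);
  hexagon : forall x y z,
    assoc y z x ∘ symm x (tens y z) ∘ assoc x y z
    = tensm (idm y) (symm x z) ∘ assoc y x z ∘ tensm (symm x y) (idm z) }.

Arguments tens {R s} x y.
Arguments tensm {R s x x' y y'} f g.
Arguments one {R s}.
Arguments assoc {R s} x y z.
Arguments assocV {R s} x y z.
Arguments lunit {R s} x.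
Arguments lunitV {R s} x.
Arguments runit {R s} x.
Arguments runitV {R s} x.
Arguments symm {R s} x y.
Notation "x ⋄ y" := (tens x y).
Notation "f ⋄₁ g" := (tensm f g).

(* The objects of the category F of R-linear functors to R-modules. *)
Record linFunctor (R : comPzRingType) (X : linCat R) := LinFunctor {
  fobj :> X -> lmodType R;
  fmap : forall x y, hom x y -> fobj x -> fobj y;
  fmap_linear : forall x y (phi : hom x y), linear (fmap phi);
  fmap_linm : forall x y (a : fobj x), linear (fun phi : hom x y => fmap phi a);
  fmap1 : forall x (a : fobj x), fmap (idm x) a = a;
  fmapM : forall x y z (psi : hom y z) (phi : hom x y) (a : fobj x),
    fmap (psi ∘ phi) a = fmap psi (fmap phi a) }.

Arguments fmap {R X} l {x y} phi a.

HB.instance Definition _ R X (F : @linFunctor R X) x y (phi : hom x y) :=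
  GRing.isLinear.Build R (F x) (F y) *:%R (fmap F phi) (fmap_linear phi).

Record monoidF (R : comPzRingType) (X : symMonCat R) := MonoidF {
  mcar :> linFunctor X;
  mmul : forall x y, mcar x -> mcar y -> mcar (x ⋄ y);
  mmul_linl : forall x y (b : mcar y), linear (fun a : mcar x => mmul a b);
  mmul_linr : forall x y (a : mcar x), linear (fun b : mcar y => mmul a b);
  mmul_nat : forall (x x' y y' : X) (phi : hom x x') (psi : hom y y')
    (a : mcar x) (b : mcar y),
    mmul (fmap mcar phi a) (fmap mcar psi b)
    = fmap mcar (phi ⋄₁ psi) (mmul a b);
  mmulA : forall x y z (a : mcar x) (b : mcar y) (c : mcar z),
    fmap mcar (assoc x y z) (mmul (mmul a b) c) = mmul a (mmul b c);
  mone : mcar one;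
  mmul1l : forall x (a : mcar x), fmap mcar (lunit x) (mmul mone a) = a;
  mmul1r : forall x (a : mcar x), fmap mcar (runit x) (mmul a mone) = a }.

Arguments mmul {R X} m {x y} a b.
Arguments mone {R X} m.

(* An N-graded monoid structure on a family F_0, F_1, ... of objects of F; the *)
(* casts are along the identities (i+j)+k = i+(j+k) and i+0 = i of N.          *)
Record gradedMonoid (R : comPzRingType) (X : symMonCat R)
    (F : nat -> linFunctor X) := GradedMonoid {
  gmul : forall i j x y, F i x -> F j y -> F (i + j)%N (x ⋄ y);
  gmul_linl : forall i j x y (b : F j y),
    linear (fun a : F i x => gmul a b);
  gmul_linr : forall i j x y (a : F i x),
    linear (fun b : F j y => gmul a b);
  gmul_nat : forall i j (x x' y y' : X) (phi : hom x x') (psi : hom y y')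
    (a : F i x) (b : F j y),
    gmul (fmap (F i) phi a) (fmap (F j) psi b)
    = fmap (F (i + j)%N) (phi ⋄₁ psi) (gmul a b);
  gmulA : forall i j k x y z (a : F i x) (b : F j y) (c : F k z),
    fmap (F (i + j + k)%N) (assoc x y z) (gmul (gmul a b) c)
    = ecast n (F n (x ⋄ (y ⋄ z))) (addnA i j k) (gmul a (gmul b c));
  gone : F 0%N one;
  gmul1l : forall i x (a : F i x),
    fmap (F (0 + i)%N) (lunit x) (gmul gone a) = a;
  gmul1r : forall i x (a : F i x),
    ecast n (F n x) (addn0 i) (fmap (F (i + 0)%N) (runit x) (gmul a gone)) = a
  }.

Arguments gmul {R X F} g {i j x y} a b.
Arguments gone {R X F} g.

Section Families.
Variables (R : comPzRingType) (X : symMonCat R).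

(* objs n is the type of n-tuples of objects and homs, elts A the n-tuples of  *)
(* morphisms, resp. of elements, over them; nested pairs are used so that      *)
(* splitting and concatenation of tuples compute.                              *)
Fixpoint objs (n : nat) : Type :=
  if n is m.+1 then (obj X * objs m)%type else unit.

Fixpoint homs (n : nat) : objs n -> objs n -> Type :=
  match n with
  | 0 => fun _ _ => unit
  | m.+1 => fun xs ys => (hom xs.1 ys.1 * homs xs.2 ys.2)%type
  end.

Fixpoint homs1 (n : nat) : forall xs : objs n, homs xs xs :=
  match n with
  | 0 => fun _ => tt
  | m.+1 => fun xs => (idm xs.1, homs1 xs.2)
  end.

Fixpoint elts (A : linFunctor X) (n : nat) : objs n -> Type :=
  match n with
  | 0 => fun _ => unit
  | m.+1 => fun xs => (A xs.1 * elts A xs.2)%type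
  end.

Fixpoint emap (A : linFunctor X) (n : nat) :
    forall xs ys : objs n, homs xs ys -> elts A xs -> elts A ys :=
  match n with
  | 0 => fun _ _ _ _ => tt
  | m.+1 => fun xs ys phi a => (fmap A phi.1 a.1, emap phi.2 a.2)
  end.

(* The bracketing x_1 ⋄ (x_2 ⋄ ( ... ⋄ (x_n ⋄ x))) of x_1 ⋄ ... ⋄ x_n ⋄ x. *)
Fixpoint tensl (n : nat) : objs n -> X -> X :=
  match n with
  | 0 => fun _ x => x
  | m.+1 => fun xs x => xs.1 ⋄ tensl xs.2 x
  end.

Fixpoint tenslm (n : nat) : forall (xs ys : objs n) (x y : X),
    homs xs ys -> hom x y -> hom (tensl xs x) (tensl ys y) :=
  match n with
  | 0 => fun _ _ _ _ _ psi => psi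
  | m.+1 => fun xs ys x y phi psi => phi.1 ⋄₁ tenslm phi.2 psi
  end.

Fixpoint multilinear (A : linFunctor X) (M : lmodType R) (n : nat) :
    forall xs : objs n, (elts A xs -> M) -> Prop :=
  match n with
  | 0 => fun _ _ => True
  | m.+1 => fun xs f =>
      (forall t : elts A xs.2, linear (fun a : A xs.1 => f (a, t))) /\
      (forall a : A xs.1, multilinear (fun t : elts A xs.2 => f (a, t)))
  end.

Lemma tenslm1 n (xs : objs n) x : tenslm (homs1 xs) (idm x) = idm (tensl xs x).
Proof. by elim: n xs => //= n IH xs; rewrite IH tensm1. Qed.

Lemma tenslm_exch n (xs ys : objs n) (x y : X) (phi : homs xs ys)
    (psi : hom x y) :
  tenslm phi (idm y) ∘ tenslm (homs1 xs) psi
  = tenslm (homs1 ys) psi ∘ tenslm phi (idm x).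
Proof.
elim: n xs ys phi => [|n IH] /= xs ys phi; first by rewrite comp1m compm1.
by rewrite -!tensmM IH comp1m compm1.
Qed.

Lemma tenslmM n (xs : objs n) (x y z : X) (psi' : hom y z) (psi : hom x y) :
  tenslm (homs1 xs) (psi' ∘ psi)
  = tenslm (homs1 xs) psi' ∘ tenslm (homs1 xs) psi.
Proof.
by elim: n xs => //= n IH xs; rewrite IH -tensmM comp1m.
Qed.

Lemma tenslm_linr n (xs ys : objs n) (x y : X) (phi : homs xs ys) :
  linear (fun psi : hom x y => tenslm phi psi).
Proof.
elim: n xs ys phi => //= n IH xs ys phi k u v; rewrite IH.
exact: tensm_linr.
Qed.

Section Multilinear.
Variable A : linFunctor X.

Lemma multilinear0 (M : lmodType R) n (xs : objs n) :
  multilinear (fun _ : elts A xs => 0 : M).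
Proof.
elim: n xs => //= n IH xs; split=> // t k u v.
by rewrite scaler0 addr0.
Qed.

Lemma multilinearZD (M : lmodType R) n (xs : objs n) k (f g : elts A xs -> M) :
  multilinear f -> multilinear g -> multilinear (fun a => k *: f a + g a).
Proof.
elim: n xs f g => //= n IH xs f g [f1 f2] [g1 g2]; split=> [t l u v|a].
  rewrite f1 g1 !scalerDr !scalerA [k * l]mulrC -!addrA; congr (_ + _).
  by rewrite addrCA.
exact: IH.
Qed.

Lemma multilinearD (M : lmodType R) n (xs : objs n) (f g : elts A xs -> M) :
  multilinear f -> multilinear g -> multilinear (fun a => f a + g a).
Proof.
move=> mf mg; have := multilinearZD 1 mf mg.
by congr multilinear; apply/funext => a; rewrite scale1r.
Qed.

Lemma multilinearZ (M : lmodType R) n (xs : objs n) k (f : elts A xs -> M) :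
  multilinear f -> multilinear (fun a => k *: f a).
Proof.
move=> mf; have := multilinearZD k mf (@multilinear0 M n xs).
by congr multilinear; apply/funext => a; rewrite addr0.
Qed.

Lemma multilinear_sum (M : lmodType R) n (xs : objs n) (I : Type) (r : seq I)
    (f : I -> elts A xs -> M) :
  (forall i, multilinear (f i)) -> multilinear (fun a => \sum_(i <- r) f i a).
Proof.
move=> mf; elim: r => [|i r IH].
  have := @multilinear0 M n xs.
  by congr multilinear; apply/funext => a; rewrite big_nil.
have := multilinearD (mf i) IH.
by congr multilinear; apply/funext => a; rewrite big_cons.
Qed.

Lemma multilinear_comp (M N : lmodType R) n (xs : objs n) (h : M -> N)
    (f : elts A xs -> M) :
  linear h -> multilinear f -> multilinear (fun a => h (f a)).
Proof.
move=> lh; elim: n xs f => //= n IH xs f [f1 f2]; split=> [t k u v|a].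
  by rewrite f1 lh.
exact: IH.
Qed.

End Multilinear.

(* The canonical morphisms that move the factors; by coherence each is the     *)
(* canonical symmetry (or associativity) between its source and target.        *)

(* (x_1 ⋄ ... ⋄ x_n ⋄ x) ⋄ x_{n+1} -> x_1 ⋄ ... ⋄ x_{n+1} ⋄ x, a tuple of      *)
(* length n+1 being cut into its first n entries and its last one.             *)
Fixpoint ofront (n : nat) : objs n.+1 -> objs n :=
  match n with
  | 0 => fun _ => tt
  | m.+1 => fun xs => (xs.1, @ofront m xs.2)
  end.

Fixpoint olast (n : nat) : objs n.+1 -> X :=
  match n with
  | 0 => fun xs => xs.1
  | m.+1 => fun xs => @olast m xs.2
  end.

Fixpoint lastm (n : nat) : forall (xs : objs n.+1) (x : X),
    hom (tensl (ofront xs) x ⋄ olast xs) (tensl xs x) :=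
  match n with
  | 0 => fun xs x => symm x xs.1
  | m.+1 => fun xs x =>
      (idm xs.1 ⋄₁ @lastm m xs.2 x) ∘ assoc _ (tensl (@ofront m xs.2) x) _
  end.

(* The tuple x_1, ..., x_{i+1} ⋄ x_{i+2}, ..., x_{n+1} for i < n (with i       *)
(* counted from 0), and the rebracketing from its product to that of the       *)
(* original tuple. For i >= n, which is never used, the value is junk.         *)
Fixpoint omerge (n i : nat) : objs n.+1 -> objs n :=
  match n with
  | 0 => fun _ => tt
  | m.+1 => fun xs =>
      if i is k.+1 then (xs.1, @omerge m k xs.2)
      else (xs.1 ⋄ xs.2.1, xs.2.2)
  end.

Fixpoint mergem (n i : nat) : forall (xs : objs n.+1) (x : X),
    hom (tensl (omerge i xs) x) (tensl xs x) :=
  match n with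
  | 0 => fun _ _ => 0
  | m.+1 =>
      match i with
      | 0 => fun xs x => assoc xs.1 xs.2.1 (tensl xs.2.2 x)
      | k.+1 => fun xs x => idm xs.1 ⋄₁ @mergem m k xs.2 x
      end
  end.

(* x ⋄ y_1 ⋄ ... ⋄ y_n ⋄ y -> y_1 ⋄ ... ⋄ y_n ⋄ x ⋄ y *)
Fixpoint passm (n : nat) : forall (ys : objs n) (x y : X),
    hom (x ⋄ tensl ys y) (tensl ys (x ⋄ y)) :=
  match n with
  | 0 => fun _ x y => idm (x ⋄ y)
  | m.+1 => fun ys x y =>
      (idm ys.1 ⋄₁ passm ys.2 x y) ∘ assoc ys.1 x (tensl ys.2 y)
      ∘ (symm x ys.1 ⋄₁ idm (tensl ys.2 y)) ∘ assocV x ys.1 (tensl ys.2 y)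
  end.

Fixpoint oleft (i j : nat) : objs (i + j)%N -> objs i :=
  match i with
  | 0 => fun _ => tt
  | k.+1 => fun zs => (zs.1, @oleft k j zs.2)
  end.

Fixpoint oright (i j : nat) : objs (i + j)%N -> objs j :=
  match i with
  | 0 => fun zs => zs
  | k.+1 => fun zs => @oright k j zs.2
  end.

(* The morphism τ of the cup product, from                                     *)
(* (x_1 ⋄ ... ⋄ x_i ⋄ x) ⋄ (y_1 ⋄ ... ⋄ y_j ⋄ y)                               *)
(* to x_1 ⋄ ... ⋄ x_i ⋄ y_1 ⋄ ... ⋄ y_j ⋄ x ⋄ y.                               *)
Fixpoint cupm (i j : nat) : forall (zs : objs (i + j)%N) (x y : X),
    hom (tensl (oleft zs) x ⋄ tensl (oright zs) y) (tensl zs (x ⋄ y)) :=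
  match i with
  | 0 => fun zs x y => passm zs x y
  | k.+1 => fun zs x y =>
      (idm zs.1 ⋄₁ @cupm k j zs.2 x y)
      ∘ assoc zs.1 (tensl (@oleft k j zs.2) x) (tensl (@oright k j zs.2) y)
  end.

Fixpoint hfront (n : nat) : forall xs ys : objs n.+1,
    homs xs ys -> homs (ofront xs) (ofront ys) :=
  match n with
  | 0 => fun _ _ _ => tt
  | m.+1 => fun xs ys phi => (phi.1, @hfront m xs.2 ys.2 phi.2)
  end.

Fixpoint hlast (n : nat) : forall xs ys : objs n.+1,
    homs xs ys -> hom (olast xs) (olast ys) :=
  match n with
  | 0 => fun _ _ phi => phi.1
  | m.+1 => fun xs ys phi => @hlast m xs.2 ys.2 phi.2
  end.

Fixpoint hmerge (n i : nat) : forall xs ys : objs n.+1,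
    homs xs ys -> homs (omerge i xs) (omerge i ys) :=
  match n with
  | 0 => fun _ _ _ => tt
  | m.+1 =>
      match i with
      | 0 => fun _ _ phi => (phi.1 ⋄₁ phi.2.1, phi.2.2)
      | k.+1 => fun xs ys phi => (phi.1, @hmerge m k xs.2 ys.2 phi.2)
      end
  end.

Fixpoint hleft (i j : nat) : forall xs ys : objs (i + j)%N,
    homs xs ys -> homs (oleft xs) (oleft ys) :=
  match i with
  | 0 => fun _ _ _ => tt
  | k.+1 => fun xs ys phi => (phi.1, @hleft k j xs.2 ys.2 phi.2)
  end.

Fixpoint hright (i j : nat) : forall xs ys : objs (i + j)%N,
    homs xs ys -> homs (oright xs) (oright ys) :=
  match i with
  | 0 => fun _ _ phi => phi
  | k.+1 => fun xs ys phi => @hright k j xs.2 ys.2 phi.2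
  end.

Lemma lastm_nat n (xs ys : objs n.+1) (x y : X) (phi : homs xs ys)
    (psi : hom x y) :
  lastm ys y ∘ (tenslm (hfront phi) psi ⋄₁ hlast phi)
  = tenslm phi psi ∘ lastm xs x.
Proof.
elim: n xs ys phi => [|n IH] xs ys phi; first exact: symm_nat.
rewrite [tenslm phi psi]/(phi.1 ⋄₁ _) /= -compA assoc_nat !compA.
by rewrite -!tensmM comp1m compm1 IH.
Qed.

Lemma comp0m (x y z : X) (f : hom x y) : (0 : hom y z) ∘ f = 0.
Proof.
have := comp_linl f (-1) (0 : hom y z) 0.
by rewrite scaler0 addr0 scaleN1r addNr.
Qed.

Lemma compm0 (x y z : X) (g : hom y z) : g ∘ (0 : hom x y) = 0.
Proof.
have := comp_linr g (-1) (0 : hom x y) 0.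
by rewrite scaler0 addr0 scaleN1r addNr.
Qed.

Lemma mergem_nat n i (xs ys : objs n.+1) (x y : X) (phi : homs xs ys)
    (psi : hom x y) :
  mergem i ys y ∘ tenslm (hmerge i phi) psi = tenslm phi psi ∘ mergem i xs x.
Proof.
elim: n i xs ys phi => [|n IH] [|i] xs ys phi; rewrite ?comp0m ?compm0 //.
  exact: assoc_nat.
rewrite [tenslm phi psi]/(phi.1 ⋄₁ _) /= -!tensmM comp1m compm1.
by rewrite -IH.
Qed.

Lemma assocV_nat (x x' y y' z z' : X) (f : hom x x') (g : hom y y')
    (h : hom z z') :
  assocV x' y' z' ∘ (f ⋄₁ (g ⋄₁ h)) = ((f ⋄₁ g) ⋄₁ h) ∘ assocV x y z.
Proof.
rewrite -[LHS]compm1 -(assocVK x y z) compA -(compA _ _ (assoc x y z)).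
by rewrite -assoc_nat !compA assocK comp1m.
Qed.

Lemma passm_nat n (xs ys : objs n) (x x' y y' : X) (phi : homs xs ys)
    (f : hom x x') (g : hom y y') :
  passm ys x' y' ∘ (f ⋄₁ tenslm phi g)
  = tenslm phi (f ⋄₁ g) ∘ passm xs x y.
Proof.
elim: n xs ys phi => [|n IH] xs ys phi /=; first by rewrite comp1m compm1.
rewrite -[_ ∘ assocV _ _ _ ∘ _]compA assocV_nat compA.
rewrite -[_ ∘ (symm _ _ ⋄₁ _) ∘ _]compA -tensmM symm_nat comp1m.
rewrite -{1}[tenslm phi.2 g]compm1 tensmM compA.
rewrite -[_ ∘ assoc _ _ _ ∘ _]compA assoc_nat compA -tensmM comp1m IH.
by rewrite !compA -tensmM compm1.
Qed.

Lemma cupm_nat i j (xs ys : objs (i + j)%N) (x x' y y' : X)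
    (phi : homs xs ys) (f : hom x x') (g : hom y y') :
  cupm ys x' y' ∘ (tenslm (hleft phi) f ⋄₁ tenslm (hright phi) g)
  = tenslm phi (f ⋄₁ g) ∘ cupm xs x y.
Proof.
elim: i xs ys phi => [|i IH] xs ys phi; first exact: passm_nat.
rewrite [tenslm phi _]/(phi.1 ⋄₁ _) /= -compA assoc_nat !compA.
by rewrite -!tensmM comp1m compm1 IH.
Qed.

Section Elements.
Variable A : monoidF X.

Fixpoint efront (n : nat) : forall xs : objs n.+1,
    elts A xs -> elts A (ofront xs) :=
  match n with
  | 0 => fun _ _ => tt
  | m.+1 => fun xs a => (a.1, @efront m xs.2 a.2)
  end.

Fixpoint elast (n : nat) : forall xs : objs n.+1, elts A xs -> A (olast xs) :=
  match n with
  | 0 => fun _ a => a.1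
  | m.+1 => fun xs a => @elast m xs.2 a.2
  end.

(* (a_1, ..., a_{i+1} × a_{i+2}, ..., a_{n+1}) *)
Fixpoint emerge (n i : nat) : forall xs : objs n.+1,
    elts A xs -> elts A (omerge i xs) :=
  match n with
  | 0 => fun _ _ => tt
  | m.+1 =>
      match i with
      | 0 => fun _ a => (mmul A a.1 a.2.1, a.2.2)
      | k.+1 => fun xs a => (a.1, @emerge m k xs.2 a.2)
      end
  end.

Fixpoint eleft (i j : nat) : forall zs : objs (i + j)%N,
    elts A zs -> elts A (oleft zs) :=
  match i with
  | 0 => fun _ _ => tt
  | k.+1 => fun zs c => (c.1, @eleft k j zs.2 c.2)
  end.

Fixpoint eright (i j : nat) : forall zs : objs (i + j)%N,
    elts A zs -> elts A (oright zs) :=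
  match i with
  | 0 => fun _ c => c
  | k.+1 => fun zs c => @eright k j zs.2 c.2
  end.

Lemma efront_nat n (xs ys : objs n.+1) (phi : homs xs ys) (a : elts A xs) :
  efront (emap phi a) = emap (hfront phi) (efront a).
Proof.
elim: n xs ys phi a => //= n IH xs ys phi a; congr pair.
exact: (IH xs.2 ys.2 phi.2 a.2).
Qed.

Lemma elast_nat n (xs ys : objs n.+1) (phi : homs xs ys) (a : elts A xs) :
  elast (emap phi a) = fmap A (hlast phi) (elast a).
Proof. by elim: n xs ys phi a => //= n IH xs ys phi; apply: IH. Qed.

Lemma emerge_nat n i (xs ys : objs n.+1) (phi : homs xs ys) (a : elts A xs) :
  emerge i (emap phi a) = emap (hmerge i phi) (emerge i a).
Proof.
elim: n i xs ys phi a => [|n IH] [|i] //= xs ys phi a.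
  by rewrite mmul_nat.
congr pair; exact: (IH i xs.2 ys.2 phi.2 a.2).
Qed.

Lemma eleft_nat i j (xs ys : objs (i + j)%N) (phi : homs xs ys)
    (a : elts A xs) :
  eleft (emap phi a) = emap (hleft phi) (eleft a).
Proof.
elim: i xs ys phi a => //= i IH xs ys phi a; congr pair.
exact: (IH xs.2 ys.2 phi.2 a.2).
Qed.

Lemma eright_nat i j (xs ys : objs (i + j)%N) (phi : homs xs ys)
    (a : elts A xs) :
  eright (emap phi a) = emap (hright phi) (eright a).
Proof. by elim: i xs ys phi a => //= i IH xs ys phi; apply: IH. Qed.

Lemma multilinear_last (M N : lmodType R) n (xs : objs n.+1)
    (B : M -> A (olast xs) -> N) (f : elts A (ofront xs) -> M) :
  (forall b, linear (B^~ b)) -> (forall m, linear (B m)) -> multilinear f ->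
  multilinear (fun a : elts A xs => B (f (efront a)) (elast a)).
Proof.
move=> B1 B2; elim: n xs B B1 B2 f => [|n IH] xs B B1 B2 f.
  by move=> _; split=> // t k u v; exact: B2.
case=> f1 f2; split=> [t k u v|a]; first by rewrite /= f1 B1.
exact: (IH xs.2 B B1 B2 (fun t => f (a, t)) (f2 a)).
Qed.

Lemma multilinear_merge (M : lmodType R) n i (xs : objs n.+1)
    (f : elts A (omerge i xs) -> M) :
  (i < n)%N -> multilinear f ->
  multilinear (fun a : elts A xs => f (emerge i a)).
Proof.
elim: n i xs f => [|n IH] [|i] //= xs f lt_i_n [f1 f2].
  split=> [t k u v|a]; first by rewrite mmul_linl f1.
  split=> [t k u v|b]; first by rewrite mmul_linr f1.
  exact: f2.
split=> [t k u v|a]; first exact: f1.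
exact: (IH i xs.2 (fun t => f (a, t)) lt_i_n (f2 a)).
Qed.

Lemma multilinear_cup (M N P : lmodType R) i j (zs : objs (i + j)%N)
    (B : M -> N -> P) (f : elts A (oleft zs) -> M)
    (g : elts A (oright zs) -> N) :
  (forall b, linear (B^~ b)) -> (forall m, linear (B m)) ->
  multilinear f -> multilinear g ->
  multilinear (fun c : elts A zs => B (f (eleft c)) (g (eright c))).
Proof.
move=> B1 B2; elim: i zs f g => [|i IH] zs f g.
  by move=> _ mg; exact: (multilinear_comp (B2 (f tt)) mg).
case=> f1 f2 mg; split=> [t k u v|a]; first by rewrite /= f1 B1.
exact: (IH zs.2 (fun t => f (a, t)) g (f2 a) mg).
Qed.

End Elements.

End Families.

Section Cochains.
Variables (R : comPzRingType) (X : symMonCat R) (A : monoidF X).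

(* The module H(A^{⊗n}, A)(x) = Hom_F(A^{⊗n}, A_x), with a morphism from       *)
(* A^{⊗n} (Day convolution) to A_x = A(- ⋄ x) given as a natural family of     *)
(* multilinear maps A(x_1) × ... × A(x_n) -> A(x_1 ⋄ ... ⋄ x_n ⋄ x). For n = 0 *)
(* such a family is an element of A(x).                                        *)
Record cochain (n : nat) (x : X) := Cochain {
  cfun :> forall xs : objs X n, elts A xs -> A (tensl xs x);
  cfun_lin : forall xs, multilinear (@cfun xs);
  cfun_nat : forall (xs ys : objs X n) (phi : homs xs ys) (a : elts A xs),
    cfun (emap phi a) = fmap A (tenslm phi (idm x)) (cfun a) }.

Lemma cochainP n x (f g : cochain n x) :
  (forall xs (a : elts A xs), f xs a = g xs a) -> f = g.
Proof.
case: f g => [f f1 f2] [g g1 g2] /= fg.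
have eqfg : f = g by apply: functional_extensionality_dep => xs; apply/funext.
by case: _ / eqfg in g1 g2 *; congr Cochain; apply: Prop_irrelevance.
Qed.

Section Module.
Variables (n : nat) (x : X).

HB.instance Definition _ := gen_eqMixin (cochain n x).
HB.instance Definition _ := gen_choiceMixin (cochain n x).

Program Definition czero : cochain n x := @Cochain n x (fun _ _ => 0) _ _.
Next Obligation. by move=> xs; apply: multilinear0. Qed.
Next Obligation. by move=> *; rewrite linear0. Qed.

Program Definition copp (f : cochain n x) : cochain n x :=
  @Cochain n x (fun xs a => - f xs a) _ _.
Next Obligation.
move=> f xs; have := multilinearZ (-1) (@cfun_lin _ _ f xs).
by congr multilinear; apply/funext => a; rewrite scaleN1r.
Qed.
Next Obligation. by move=> * /=; rewrite cfun_nat linearN. Qed.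

Program Definition cadd (f g : cochain n x) : cochain n x :=
  @Cochain n x (fun xs a => f xs a + g xs a) _ _.
Next Obligation. by move=> *; apply: multilinearD; apply: cfun_lin. Qed.
Next Obligation. by move=> * /=; rewrite !cfun_nat linearD. Qed.

Program Definition cscale (k : R) (f : cochain n x) : cochain n x :=
  @Cochain n x (fun xs a => k *: f xs a) _ _.
Next Obligation. by move=> *; apply: multilinearZ; apply: cfun_lin. Qed.
Next Obligation. by move=> * /=; rewrite !cfun_nat linearZ. Qed.

Lemma caddA : associative cadd.
Proof. by move=> f g h; apply: cochainP => * /=; rewrite addrA. Qed.
Lemma caddC : commutative cadd.
Proof. by move=> f g; apply: cochainP => * /=; rewrite addrC. Qed.
Lemma cadd0 : left_id czero cadd.
Proof. by move=> f; apply: cochainP => * /=; rewrite add0r. Qed.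
Lemma caddN : left_inverse czero copp cadd.
Proof. by move=> f; apply: cochainP => * /=; rewrite addNr. Qed.

HB.instance Definition _ :=
  GRing.isZmodule.Build (cochain n x) caddA caddC cadd0 caddN.

Lemma cscaleA k l f : cscale k (cscale l f) = cscale (k * l) f.
Proof. by apply: cochainP => * /=; rewrite scalerA. Qed.
Lemma cscale1 : left_id 1 cscale.
Proof. by move=> f; apply: cochainP => * /=; rewrite scale1r. Qed.
Lemma cscaleDr : right_distributive cscale +%R.
Proof. by move=> k f g; apply: cochainP => * /=; rewrite scalerDr. Qed.
Lemma cscaleDl f : {morph cscale^~ f : k l / k + l}.
Proof. by move=> k l; apply: cochainP => * /=; rewrite scalerDl. Qed.

HB.instance Definition _ := GRing.Zmodule_isLmodule.Build R (cochain n x)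
  cscaleA cscale1 cscaleDr cscaleDl.

Lemma cochainZDE k (f g : cochain n x) xs (a : elts A xs) :
  (k *: f + g) xs a = k *: f xs a + g xs a.
Proof. by []. Qed.

End Module.

(* Functoriality of x |-> H(A^{⊗n}, A)(x). *)
Program Definition cmap n (x y : X) (psi : hom x y) (f : cochain n x) :
    cochain n y :=
  @Cochain n y (fun xs a => fmap A (tenslm (homs1 xs) psi) (f xs a)) _ _.
Next Obligation.
move=> n x y psi f xs; apply: multilinear_comp (@cfun_lin _ _ f xs).
exact: fmap_linear.
Qed.
Next Obligation.
by move=> n x y psi f xs ys phi a /=; rewrite cfun_nat -!fmapM tenslm_exch.
Qed.

Program Definition cochainF n : linFunctor X :=
  @LinFunctor R X (fun x => cochain n x) (@cmap n) _ _ _ _.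
Next Obligation.
by move=> n x y psi k f g; apply: cochainP => xs a /=; rewrite linearP.
Qed.
Next Obligation.
move=> n x y f k phi psi; apply: cochainP => xs a /=.
by rewrite tenslm_linr fmap_linm.
Qed.
Next Obligation.
by move=> n x f; apply: cochainP => xs a /=; rewrite tenslm1 fmap1.
Qed.
Next Obligation.
by move=> n x y z psi phi f; apply: cochainP => xs a /=; rewrite tenslmM fmapM.
Qed.

(* With m : 'I_n the i-th summand (1 <= i <= n) of the usual formula has       *)
(* i = m + 1.                                                                  *)
Definition beta_fun n x (f : cochain n x) (xs : objs X n.+1) (a : elts A xs) :
    A (tensl xs x) :=
  mmul A a.1 (f xs.2 a.2)
  + \sum_(m < n) (-1) ^+ m.+1 *:
      fmap A (mergem m xs x) (f (omerge m xs) (emerge m a))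
  + (-1) ^+ n.+1 *:
      fmap A (lastm xs x) (mmul A (f (ofront xs) (efront a)) (elast a)).

Program Definition beta n x (f : cochain n x) : cochain n.+1 x :=
  @Cochain n.+1 x (@beta_fun n x f) _ _.
Next Obligation.
move=> n x f xs; apply: multilinearD; first apply: multilinearD.
- split=> [t k u v|a]; first exact: mmul_linl.
  exact: (multilinear_comp (@mmul_linr _ _ A _ _ a) (@cfun_lin _ _ f xs.2)).
- apply: multilinear_sum => m; apply: multilinearZ.
  apply: multilinear_comp; first exact: fmap_linear.
  apply: (multilinear_merge (f := @cfun _ _ f (omerge m xs))) => //.
  exact: cfun_lin.
- apply: multilinearZ; apply: multilinear_comp; first exact: fmap_linear.
  apply: (multilinear_last (B := fun u v => mmul A u v)
    (f := @cfun _ _ f (ofront xs))); last exact: cfun_lin.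
    by move=> b; apply: mmul_linl.
  by move=> u; apply: mmul_linr.
Qed.
Next Obligation.
move=> n x f xs ys phi a; rewrite /beta_fun !linearD linear_sum.
congr (_ + _ + _).
- by rewrite -(fmap1 (f xs.2 a.2)) /= cfun_nat mmul_nat fmap1.
- apply: eq_bigr => m _; rewrite linearZ /=; congr (_ *: _).
  by rewrite -fmapM -mergem_nat fmapM -cfun_nat -emerge_nat.
- rewrite linearZ /=; congr (_ *: _).
  by rewrite -fmapM -lastm_nat fmapM -mmul_nat -cfun_nat -efront_nat elast_nat.
Qed.

Lemma beta_linear n x : linear (@beta n x).
Proof.
move=> k f g; apply: cochainP => xs a; rewrite cochainZDE /= /beta_fun.
rewrite !cochainZDE mmul_linr mmul_linl linearP scalerDr !scalerDr scaler_sumr.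
under eq_bigr do rewrite cochainZDE linearP scalerDr scalerA mulrC -scalerA.
rewrite big_split /= scalerA [_ * k]mulrC -scalerA.
by rewrite -!addrA; congr (_ + _); rewrite addrCA; congr (_ + _);
   rewrite [RHS]addrCA; congr (_ + _); rewrite addrCA.
Qed.

Lemma beta_nat n x y (psi : hom x y) (f : cochain n x) :
  beta (cmap psi f) = cmap psi (beta f).
Proof.
apply: cochainP => xs a; rewrite /= /beta_fun /= !linearD linear_sum.
have hf k (zs : objs X k.+1) : hfront (homs1 zs) = homs1 (ofront zs).
  by elim: k zs => //= k IH zs; congr pair; apply: (IH zs.2).
have hl k (zs : objs X k.+1) : hlast (homs1 zs) = idm (olast zs).
  by elim: k zs => //= k IH zs; apply: (IH zs.2).
have hm k i (zs : objs X k.+1) : hmerge i (homs1 zs) = homs1 (omerge i zs).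
  elim: k i zs => [|k IH] [|i] //= zs; first by rewrite tensm1.
  by congr pair; apply: (IH i zs.2).
congr (_ + _ + _).
- by rewrite /= -{1}[a.1]fmap1 mmul_nat.
- apply: eq_bigr => m _; rewrite linearZ /=; congr (_ *: _).
  by rewrite -!fmapM; have := mergem_nat m (homs1 xs) psi; rewrite hm => ->.
- rewrite linearZ /=; congr (_ *: _).
  rewrite -{1}[elast a]fmap1 mmul_nat -!fmapM.
  have := lastm_nat (homs1 xs) psi; rewrite hf hl => ->.
  by [].
Qed.

Program Definition cup i j x y (f : cochain i x) (g : cochain j y) :
    cochain (i + j)%N (x ⋄ y) :=
  @Cochain (i + j)%N (x ⋄ y) (fun zs c =>
    fmap A (cupm zs x y)
      (mmul A (f (oleft zs) (eleft c)) (g (oright zs) (eright c)))) _ _.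
Next Obligation.
move=> i j x y f g zs; apply: multilinear_comp; first exact: fmap_linear.
apply: (multilinear_cup (B := fun u v => mmul A u v)
  (f := @cfun _ _ f (oleft zs)) (g := @cfun _ _ g (oright zs))).
- by move=> b; apply: mmul_linl.
- by move=> u; apply: mmul_linr.
- exact: cfun_lin.
- exact: cfun_lin.
Qed.
Next Obligation.
move=> i j x y f g zs zs' phi c /=.
by rewrite -fmapM -tensm1 -cupm_nat fmapM -mmul_nat -!cfun_nat eleft_nat
  eright_nat.
Qed.

End Cochains.

Notation "f ⌣ g" := (cup f g).

(* Sequences C_0 -> C_1 -> ... in F and their cohomology. The n-th cohomology  *)
(* at x is Z / (Z ∩ B), where Z is the kernel of d on C_n(x) and B the image   *)
(* of d in C_n(x) (and 0 if n = 0). For a complex B is contained in Z, so that *)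
(* this is Z / B; the definition does not need d ∘ d = 0.                      *)
Record cochainSeq (R : comPzRingType) (X : linCat R) := CochainSeq {
  cxobj :> nat -> linFunctor X;
  cxd : forall n x, cxobj n x -> cxobj n.+1 x;
  cxd_linear : forall n x, linear (@cxd n x);
  cxd_nat : forall n x y (psi : hom x y) (f : cxobj n x),
    cxd (fmap (cxobj n) psi f) = fmap (cxobj n.+1) psi (cxd f) }.

Arguments cxd {R X} c {n x} f.

HB.instance Definition _ R X (C : @cochainSeq R X) n x :=
  GRing.isLinear.Build R (C n x) (C n.+1 x) *:%R (@cxd R X C n x)
    (@cxd_linear R X C n x).

Section Cohomology.
Variables (R : comPzRingType) (X : linCat R) (C : cochainSeq X).

Definition is_cobound n : forall x, C n x -> Prop :=
  match n with
  | 0 => fun x f => f = 0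
  | m.+1 => fun x f => exists h : C m x, f = cxd C h
  end.

Lemma is_cobound0 n x : is_cobound (0 : C n x).
Proof. by case: n => [|n] //=; exists 0; rewrite linear0. Qed.

Lemma is_coboundZD n x k (f g : C n x) :
  is_cobound f -> is_cobound g -> is_cobound (k *: f + g).
Proof.
case: n f g => [|n] f g /=; first by move=> -> ->; rewrite scaler0 addr0.
by move=> [h ->] [h' ->]; exists (k *: h + h'); rewrite linearP.
Qed.

Lemma is_cobound_fmap n x y (psi : hom x y) (f : C n x) :
  is_cobound f -> is_cobound (fmap (C n) psi f).
Proof.
case: n f => [|n] f /=; first by move=> ->; rewrite linear0.
by move=> [h ->]; exists (fmap (C n) psi h); rewrite cxd_nat.
Qed.

Section At.
Variables (n : nat) (x : X).

Definition cocyclep : {pred C n x} := fun f => cxd C f == 0.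

Lemma cocyclep_closed : submod_closed cocyclep.
Proof.
split=> [|k f g]; rewrite !unfold_in ?linear0 // => /eqP f0 /eqP g0.
by rewrite linearP /= f0 g0 scaler0 addr0.
Qed.
HB.instance Definition _ :=
  GRing.isSubmodClosed.Build R (C n x) cocyclep cocyclep_closed.

Record cocycle := Cocycle { cval :> C n x; cvalP : cval \in cocyclep }.
HB.instance Definition _ := [isSub for cval].
HB.instance Definition _ := [Choice of cocycle by <:].
HB.instance Definition _ := [SubChoice_isSubLmodule of cocycle by <:].

Definition coboundp : {pred cocycle} :=
  fun f => `[< is_cobound (cval f) >].

Lemma coboundp_closed : submod_closed coboundp.
Proof.
split=> [|k f g]; first by apply/asboolP; exact: is_cobound0.
by move=> /asboolP hf /asboolP hg; apply/asboolP; exact: is_coboundZD.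
Qed.
HB.instance Definition _ :=
  GRing.isSubmodClosed.Build R cocycle coboundp coboundp_closed.

Definition cohom : Type := {ideal_quot coboundp}.
HB.instance Definition _ := GRing.Zmodule.on cohom.

Definition cls (f : cocycle) : cohom := \pi_({ideal_quot coboundp}) f.

Lemma cls_eq (f g : cocycle) : cls f = cls g <-> is_cobound (cval f - cval g).
Proof.
rewrite -[_ - _]/(cval (f - g)); apply: (iff_trans (rwP eqP)).
rewrite /cls -Quotient.idealrBE; exact: iff_sym (rwP (asboolP _)).
Qed.

Lemma clsD f g : cls (f + g) = cls f + cls g.
Proof. by rewrite /cls; exact: Quotient.pi_add. Qed.

Lemma cls_surj (u : cohom) : exists f, u = cls f.
Proof. by exists (repr u); rewrite /cls reprK. Qed.

Definition hscale (k : R) (u : cohom) : cohom :=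
  cls (k *: (repr (u : {ideal_quot coboundp}))).

Lemma hscale_cls k f : hscale k (cls f) = cls (k *: f).
Proof.
rewrite /hscale; apply/cls_eq.
rewrite -[_ - _]/(cval (k *: _ - k *: f)) -scalerBr.
have /cls_eq h : cls (repr (cls f : {ideal_quot coboundp})) = cls f.
  by rewrite /cls reprK.
have := is_coboundZD k h (is_cobound0 n x).
by rewrite addr0.
Qed.

Lemma hscaleA k l u : hscale k (hscale l u) = hscale (k * l) u.
Proof.
by case: (cls_surj u) => f ->; rewrite !hscale_cls scalerA.
Qed.
Lemma hscale1 : left_id 1 hscale.
Proof. by move=> u; case: (cls_surj u) => f ->; rewrite hscale_cls scale1r. Qed.
Lemma hscaleDr : right_distributive hscale +%R.
Proof.
move=> k u v; case: (cls_surj u) (cls_surj v) => f -> [g ->].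
by rewrite -clsD !hscale_cls scalerDr clsD.
Qed.
Lemma hscaleDl u : {morph hscale^~ u : k l / k + l}.
Proof.
by move=> k l; case: (cls_surj u) => f ->; rewrite !hscale_cls scalerDl clsD.
Qed.
HB.instance Definition _ := GRing.Zmodule_isLmodule.Build R cohom
  hscaleA hscale1 hscaleDr hscaleDl.

Lemma clsZD k f g : cls (k *: f + g) = k *: cls f + cls g.
Proof. by rewrite clsD -hscale_cls. Qed.

End At.

Lemma fmap_cocycle n x y (psi : hom x y) (f : cocycle n x) :
  fmap (C n) psi (cval f) \in @cocyclep n y.
Proof.
by apply/eqP; rewrite cxd_nat; move/eqP: (cvalP f) => ->; rewrite linear0.
Qed.

Definition zmap n x y (psi : hom x y) (f : cocycle n x) : cocycle n y :=
  Cocycle (fmap_cocycle psi f).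

Definition hmap n x y (psi : hom x y) (u : cohom n x) : cohom n y :=
  cls (zmap psi (repr (u : {ideal_quot @coboundp n x}))).

Lemma hmap_cls n x y (psi : hom x y) (f : cocycle n x) :
  hmap psi (cls f) = cls (zmap psi f).
Proof.
apply/cls_eq; rewrite /= -linearB; apply: is_cobound_fmap.
by apply/cls_eq; rewrite /cls reprK.
Qed.

Program Definition cohomF n : linFunctor X :=
  @LinFunctor R X (fun x => cohom n x) (@hmap n) _ _ _ _.
Next Obligation.
move=> n x y psi k u v; case: (cls_surj u) (cls_surj v) => f -> [g ->].
rewrite -clsZD !hmap_cls -clsZD; congr cls; apply: val_inj => /=.
exact: fmap_linear.
Qed.
Next Obligation.
move=> n x y u k phi psi; case: (cls_surj u) => f ->.
rewrite !hmap_cls -clsZD; congr cls; apply: val_inj => /=.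
exact: fmap_linm.
Qed.
Next Obligation.
move=> n x u; case: (cls_surj u) => f ->; rewrite hmap_cls; congr cls.
by apply: val_inj => /=; rewrite fmap1.
Qed.
Next Obligation.
move=> n x y z psi phi u; case: (cls_surj u) => f ->.
by rewrite !hmap_cls; congr cls; apply: val_inj => /=; rewrite fmapM.
Qed.

(* The class of a cocycle. *)
Definition hclass n x (f : C n x) (hf : cxd C f = 0) : cohomF n x :=
  cls (@Cocycle n x f (introT eqP hf)).

End Cohomology.

Section Hochschild.
Variables (R : comPzRingType) (X : symMonCat R) (A : monoidF X).

Definition hochschild : cochainSeq X :=
  @CochainSeq R X (cochainF A) (@beta R X A) (@beta_linear R X A)
    (@beta_nat R X A).

Definition HH (n : nat) : linFunctor X := cohomF hochschild n.

Definition HHclass n x (f : cochain A n x) (hf : beta f = 0) : HH n x :=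
  @hclass R X hochschild n x f hf.

Definition commutant (x : X) (m : A x) : Prop :=
  forall (y : X) (a : A y), mmul A a m = fmap A (symm x y) (mmul A m a).

(* The identification of A(x) with the cochains of degree 0. *)
Program Definition cochain0 (x : X) (m : A x) : cochain A 0 x :=
  @Cochain R X A 0 x (fun _ _ => m) _ _.
Next Obligation. by []. Qed.
Next Obligation. by move=> x m xs ys phi a /=; rewrite fmap1. Qed.

Lemma cochain0_surj x (f : cochain A 0 x) : f = cochain0 (f tt tt).
Proof. by apply: cochainP => -[] []. Qed.

Lemma beta_cochain0 x (m : A x) y (a : A y) :
  beta (cochain0 m) (y, tt) (a, tt)
  = mmul A a m - fmap A (symm x y) (mmul A m a).
Proof. by rewrite /= /beta_fun big_ord0 addr0 scaleN1r. Qed.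

Lemma commutantP x (m : A x) : commutant m <-> beta (cochain0 m) = 0.
Proof.
split=> [cm|b0 y a].
  apply: cochainP => -[y []] [a []]; rewrite beta_cochain0 cm.
  exact: subrr.
by apply/eqP; rewrite -subr_eq0 -beta_cochain0 b0.
Qed.

(* The identification of the commutant CA(x) with HH^0(A, A)(x). *)
Definition CA_HH0 x (m : A x) (hm : commutant m) : HH 0%N x :=
  HHclass (proj1 (commutantP m) hm).

Lemma CA_HH0_inj x (m m' : A x) (hm : commutant m) (hm' : commutant m') :
  CA_HH0 hm = CA_HH0 hm' -> m = m'.
Proof.
move=> /cls_eq /= h; apply/eqP; rewrite -subr_eq0; apply/eqP.
exact: (congr1 (fun f : cochain A 0 x => f tt tt) h).
Qed.

Lemma CA_HH0_surj x (u : HH 0%N x) :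
  exists (m : A x) (hm : commutant m), u = CA_HH0 hm.
Proof.
case: (cls_surj u) => -[f hf] ->; exists (f tt tt).
have hm : commutant (f tt tt).
  by apply/commutantP; rewrite -cochain0_surj; apply/eqP.
exists hm; congr cls; apply: val_inj => /=; exact: cochain0_surj.
Qed.

End Hochschild.

(* Main.v *)
From HB Require Import structures.
Require Import Defs.
From mathcomp Require Import all_boot all_algebra.
From mathcomp Require Import boolp.
Import Defs.

Set Implicit Arguments.
Unset Strict Implicit.
Unset Printing Implicit Defensive.

Import GRing.Theory.
Local Open Scope ring_scope.

(* Each face of the coboundary of [f ⌣ g] is a face of [f] or of [g]: merging *)
(* two of the first i arguments is done inside [f], merging two of the last j *)
(* inside [g], and the last face of [f] equals the first face of [g] with the *)
(* opposite sign, so that these two cancel. Each of these identities, as well *)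
(* as associativity and the unit laws, holds because two composites of *)
(* associativities and symmetries agree. All these composites are assembled *)
(* from the morphism [swapm] moving one factor past another, and the *)
(* coherence needed reduces to a few identities on [swapm] following from the *)
(* pentagon and the hexagon. *)

(** * Coherence *)

(** On i + j + 1 arguments, the inner faces of [beta (f ⌣ g)] divide at i into merges inside [f]
    ([cup_mergel]) and merges inside [g] ([cup_merger]), while the outer faces are [mmul_cup] and
    [cup_last]. The products [beta f ⌣ g] and [f ⌣ beta g] supply exactly these terms and one more
    each; the two extra terms agree by [cup_middle] and have opposite signs. This is [beta_cup].

    By this Leibniz rule cocycles are closed under the product, and a cocycle times a coboundary, on
    either side, is a coboundary, so the product descends to classes ([HHcup_cls]). Bilinearity,
    naturality, associativity and the unit laws hold already for cochains, up to casts between equal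
    degrees, and pass to classes. *)

HB.lock
Definition swapm (R : comPzRingType) (X : symMonCat R) (x z t : X) :
    hom (x ⋄ (z ⋄ t)) (z ⋄ (x ⋄ t)) :=
  assoc z x t ∘ (symm x z ⋄₁ idm t) ∘ assocV x z t.

Section Coherence.
Variables (R : comPzRingType) (X : symMonCat R).
Implicit Types x y z t w : X.

Lemma comp_reassoc x y z w (f : hom y z) (g : hom x y) (h : hom x z) :
  f ∘ g = h -> forall k : hom w x, f ∘ (g ∘ k) = h ∘ k.
Proof. by move=> fg k; rewrite compA fg. Qed.

Lemma comp_epi x y z (g : hom x y) (g' : hom y x) :
  g ∘ g' = idm y -> forall f f' : hom y z, f ∘ g = f' ∘ g -> f = f'.
Proof.
by move=> gK f f' e; rewrite -(compm1 f) -gK compA e -compA gK compm1.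
Qed.

Lemma comp_mono x y z (g : hom y z) (g' : hom z y) :
  g' ∘ g = idm y -> forall f f' : hom x y, g ∘ f = g ∘ f' -> f = f'.
Proof.
by move=> gK f f' e; rewrite -(comp1m f) -gK -compA e compA gK comp1m.
Qed.

Lemma tensm1M x y z w (f : hom y z) (g : hom x y) :
  (idm w ⋄₁ f) ∘ (idm w ⋄₁ g) = idm w ⋄₁ (f ∘ g).
Proof. by rewrite -tensmM comp1m. Qed.

Lemma tensmM1 x y z w (f : hom y z) (g : hom x y) :
  (f ⋄₁ idm w) ∘ (g ⋄₁ idm w) = (f ∘ g) ⋄₁ idm w.
Proof. by rewrite -tensmM comp1m. Qed.

Lemma assoc_natr x y z z' (h : hom z z') :
  assoc x y z' ∘ (idm (x ⋄ y) ⋄₁ h) = (idm x ⋄₁ (idm y ⋄₁ h)) ∘ assoc x y z.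
Proof. by rewrite -tensm1 assoc_nat. Qed.

Lemma assoc_natl x x' y z (f : hom x x') :
  assoc x' y z ∘ ((f ⋄₁ idm y) ⋄₁ idm z) = (f ⋄₁ idm (y ⋄ z)) ∘ assoc x y z.
Proof. by rewrite assoc_nat tensm1. Qed.

Lemma assoc_tensl_epi x y z w t (f f' : hom (x ⋄ (y ⋄ z) ⋄ w) t) :
  f ∘ (assoc x y z ⋄₁ idm w) = f' ∘ (assoc x y z ⋄₁ idm w) -> f = f'.
Proof.
apply: (comp_epi (g' := assocV x y z ⋄₁ idm w)).
by rewrite tensmM1 assocVK tensm1.
Qed.

(** Tensoring with the unit object is naturally isomorphic to the identity functor through [lunit],
    hence faithful. *)
Lemma tens1l_inj z t (f g : hom z t) : idm one ⋄₁ f = idm one ⋄₁ g -> f = g.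
Proof. by move=> fg; apply: (comp_epi (lunitVK z)); rewrite -!lunit_nat fg. Qed.

Lemma tens1r_inj z t (f g : hom z t) : f ⋄₁ idm one = g ⋄₁ idm one -> f = g.
Proof. by move=> fg; apply: (comp_epi (runitVK z)); rewrite -!runit_nat fg. Qed.

(* Kelly's argument: the units of [triangle] with an extra factor, cancelled *)
(* by faithfulness of tensoring with the unit object. *)
Lemma lunit_assoc x y :
  lunit (x ⋄ y) ∘ assoc one x y = lunit x ⋄₁ idm y.
Proof.
apply: tens1l_inj; apply: (comp_epi (assocVK _ _ _)).
apply: assoc_tensl_epi.
rewrite -tensm1M -!compA (compA (idm _ ⋄₁ assoc _ _ _)) -pentagon.
rewrite compA triangle -assoc_natl -triangle -tensmM1.
by rewrite compA assoc_nat -!compA.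
Qed.

(** Mirror image of [lunit_assoc]: the pentagon with the unit object in its last two places. *)
Lemma runit_assoc x y :
  (idm x ⋄₁ runit y) ∘ assoc x y one = runit (x ⋄ y).
Proof.
apply: tens1r_inj; apply: (comp_mono (assocK _ _ _)).
rewrite -tensmM1 compA assoc_nat -triangle -tensm1M -!compA.
rewrite (compA (idm _ ⋄₁ assoc _ _ _)) -pentagon compA -assoc_natr -compA.
by rewrite triangle.
Qed.

(** The hexagon at [x], [one], [one], with the units removed by [lunit_assoc] and the triangle. *)
Lemma lunit_symm x : lunit x ∘ symm x one = runit x.
Proof.
apply: tens1r_inj; apply: (comp_mono (symmK _ _)).
rewrite -tensmM1 -lunit_assoc -!compA (comp_reassoc (esym (lunit_nat _))).
rewrite -!compA (compA (idm _ ⋄₁ _) (assoc _ _ _)) -hexagon.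
by rewrite !compA lunit_assoc -symm_nat -compA triangle.
Qed.

Lemma runit_symm x : runit x ∘ symm one x = lunit x.
Proof. by rewrite -lunit_symm -compA symmK compm1. Qed.

Lemma swapmE x z t :
  swapm x z t = assoc z x t ∘ (symm x z ⋄₁ idm t) ∘ assocV x z t.
Proof. by rewrite swapm.unlock. Qed.

(** Eliminates the inverse associativity inside [swapm]. Identities on [swapm] are therefore proved
    after precomposition with an associativity, which [comp_epi] cancels. *)
Lemma swapm_assoc x z t :
  swapm x z t ∘ assoc x z t = assoc z x t ∘ (symm x z ⋄₁ idm t).
Proof. by rewrite swapmE -!compA assocK compm1. Qed.

Lemma swapm_nat x x' z z' t t' (f : hom x x') (g : hom z z') (h : hom t t') :
  swapm x' z' t' ∘ (f ⋄₁ (g ⋄₁ h)) = (g ⋄₁ (f ⋄₁ h)) ∘ swapm x z t.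
Proof.
rewrite !swapmE -!compA assocV_nat (compA (symm _ _ ⋄₁ _)) -tensmM symm_nat.
by rewrite comp1m -{1}(compm1 h) tensmM !compA assoc_nat.
Qed.

(** The hexagon tensored with [t]: passing a product is passing its factors in turn. *)
Lemma assoc_swapm x z1 z2 t :
  assoc z1 z2 (x ⋄ t) ∘ swapm x (z1 ⋄ z2) t
  = (idm z1 ⋄₁ swapm x z2 t) ∘ swapm x z1 (z2 ⋄ t)
    ∘ (idm x ⋄₁ assoc z1 z2 t).
Proof.
apply: (comp_epi (assocVK _ _ _)); apply: assoc_tensl_epi.
rewrite -!compA (compA (idm x ⋄₁ _)) -pentagon.
rewrite !(comp_reassoc (swapm_assoc _ _ _)) -!compA.
rewrite -assoc_natl !(comp_reassoc (pentagon _ _ _ _)) -!compA.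
rewrite (comp_reassoc (tensm1M _ _ _)) swapm_assoc -tensm1M -!compA.
rewrite (comp_reassoc (esym (assoc_nat _ _ _))) -!compA !tensmM1.
by rewrite !compA hexagon.
Qed.

(** Needs only the pentagon and naturality, since [w] stays to the right of the swap. *)
Lemma swapm_assocr x z t w :
  swapm x z (t ⋄ w) ∘ (idm x ⋄₁ assoc z t w) ∘ assoc x (z ⋄ t) w
  = (idm z ⋄₁ assoc x t w) ∘ assoc z (x ⋄ t) w ∘ (swapm x z t ⋄₁ idm w).
Proof.
apply: assoc_tensl_epi.
rewrite -!compA (compA (idm x ⋄₁ _)) -pentagon.
rewrite (comp_reassoc (swapm_assoc _ _ _)) -!compA -assoc_natl.
rewrite (comp_reassoc (pentagon _ _ _ _)) -!compA !tensmM1 swapm_assoc.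
by [].
Qed.

(** The second hexagon, obtained from the first by inverting the symmetries. *)
Lemma symm_tensl x y z :
  swapm x z y ∘ (idm x ⋄₁ symm y z) ∘ assoc x y z = symm (x ⋄ y) z.
Proof.
apply: (comp_epi (symmK (x ⋄ y) z)); rewrite symmK.
apply: (comp_epi (assocVK z x y)); rewrite -!compA (compA (assoc x y z)).
rewrite hexagon -!compA (comp_reassoc (tensm1M _ _ _)) symmK tensm1 comp1m.
rewrite (comp_reassoc (swapm_assoc _ _ _)) -compA tensmM1 symmK tensm1.
by rewrite compm1 comp1m.
Qed.

(** [symm_tensl] with a further factor [t]. *)
Lemma swapm_tensl x y z t :
  swapm x z (y ⋄ t) ∘ (idm x ⋄₁ swapm y z t) ∘ assoc x y (z ⋄ t)
  = (idm z ⋄₁ assoc x y t) ∘ swapm (x ⋄ y) z t.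
Proof.
apply: (comp_epi (assocVK _ _ _)).
rewrite -!compA swapm_assoc pentagon -!compA.
rewrite (comp_reassoc (tensm1M _ _ _)) swapm_assoc -tensm1M -!compA.
rewrite (comp_reassoc (esym (assoc_nat _ _ _))) -!compA tensmM1.
rewrite (compA (swapm _ _ _)) (compA (swapm _ _ _ ∘ _)) swapm_assocr.
by rewrite -!compA !tensmM1 !compA symm_tensl.
Qed.

Lemma lunit_swapm z t :
  (idm z ⋄₁ lunit t) ∘ swapm one z t = lunit (z ⋄ t).
Proof.
apply: (comp_epi (assocVK _ _ _)).
by rewrite -compA swapm_assoc compA triangle tensmM1 runit_symm lunit_assoc.
Qed.

End Coherence.

(** * Moving a factor past a whole tuple *)

Section Cons.
Variables (R : comPzRingType) (X : symMonCat R).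

(** The recursion step common to [lastm] and [cupm]; [consm3] is its analogue for a source with
    three factors. *)
Definition consm (z : X) L M T (h : hom (L ⋄ M) T) :
    hom ((z ⋄ L) ⋄ M) (z ⋄ T) :=
  (idm z ⋄₁ h) ∘ assoc z L M.

Definition consm3 (z : X) L M N T (h : hom ((L ⋄ M) ⋄ N) T) :
    hom (((z ⋄ L) ⋄ M) ⋄ N) (z ⋄ T) :=
  consm z h ∘ (assoc z L M ⋄₁ idm N).

Lemma tens_consm (z : X) L M T T' (f : hom T T') (h : hom (L ⋄ M) T) :
  (idm z ⋄₁ f) ∘ consm z h = consm z (f ∘ h).
Proof. by rewrite /consm compA tensm1M. Qed.

Lemma consm_tensl (z : X) L L' M T (f : hom L L') (h : hom (L' ⋄ M) T) :
  consm z h ∘ ((idm z ⋄₁ f) ⋄₁ idm M) = consm z (h ∘ (f ⋄₁ idm M)).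
Proof. by rewrite /consm -compA assoc_nat compA tensm1M. Qed.

Lemma consm_tensr (z : X) L M M' T (f : hom M M') (h : hom (L ⋄ M') T) :
  consm z h ∘ (idm (z ⋄ L) ⋄₁ f) = consm z (h ∘ (idm L ⋄₁ f)).
Proof. by rewrite /consm -compA assoc_natr compA tensm1M. Qed.

Lemma consm_consm (z : X) L M N T T' (f : hom (L ⋄ M) T) (h : hom (T ⋄ N) T') :
  consm z h ∘ (consm z f ⋄₁ idm N) = consm3 z (h ∘ (f ⋄₁ idm N)).
Proof. by rewrite -tensmM1 compA consm_tensl. Qed.

Lemma consm_assoc (z : X) L M N T (h : hom (L ⋄ (M ⋄ N)) T) :
  consm z h ∘ assoc (z ⋄ L) M N = consm3 z (h ∘ assoc L M N).
Proof.
by rewrite /consm3 /consm -!compA pentagon !compA tensm1M.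
Qed.

Lemma passmS n (ys : objs X n.+1) x y :
  passm ys x y = (idm ys.1 ⋄₁ passm ys.2 x y) ∘ swapm x ys.1 (tensl ys.2 y).
Proof. by rewrite swapmE !compA. Qed.

Lemma lunit_passm n (ys : objs X n) y :
  tenslm (homs1 ys) (lunit y) ∘ passm ys one y = lunit (tensl ys y).
Proof.
elim: n ys => [|n IH] ys; first by rewrite /= compm1.
rewrite passmS [tenslm _ _]/(idm ys.1 ⋄₁ _) compA tensm1M IH.
exact: lunit_swapm.
Qed.

Lemma passm_tens n (ys : objs X n) x y z :
  tenslm (homs1 ys) (assoc x y z) ∘ passm ys (x ⋄ y) z
  = passm ys x (y ⋄ z) ∘ (idm x ⋄₁ passm ys y z) ∘ assoc x y (tensl ys z).
Proof.
elim: n ys => [|n IH] ys; first by rewrite /= tensm1 !comp1m compm1.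
rewrite !passmS [tenslm _ _]/(idm ys.1 ⋄₁ tenslm (homs1 ys.2) _).
rewrite compA tensm1M IH -!tensm1M -!compA.
rewrite -swapm_tensl -!compA; congr (_ ∘ _).
by rewrite !compA swapm_nat.
Qed.

(** The induction step shared by [passm_lastm] and [passm_cupm]: [a], [b] are built by [consm] and
    [p], [q] by [passm]. *)
Lemma swapm_consm (x z L M N T T' : X) (a : hom (T ⋄ N) T')
    (b : hom (L ⋄ N) M) (p : hom (x ⋄ M) T') (q : hom (x ⋄ L) T) :
  a ∘ (q ⋄₁ idm N) = p ∘ (idm x ⋄₁ b) ∘ assoc x L N ->
  consm z a ∘ ((idm z ⋄₁ q) ∘ swapm x z L ⋄₁ idm N)
  = (idm z ⋄₁ p) ∘ swapm x z M ∘ (idm x ⋄₁ consm z b) ∘ assoc x (z ⋄ L) N.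
Proof.
move=> e; rewrite -tensmM1 compA consm_tensl e /consm -!compA -!tensm1M -!compA.
rewrite (compA (idm z ⋄₁ assoc _ _ _)) -swapm_assocr.
rewrite !compA -(compA _ (swapm _ _ _) (idm x ⋄₁ (idm z ⋄₁ _))) swapm_nat.
by rewrite !compA.
Qed.

Lemma tens_swapm (x z L M T T' : X) (a : hom T T') (b : hom L M)
    (p : hom (x ⋄ M) T') (q : hom (x ⋄ L) T) :
  a ∘ q = p ∘ (idm x ⋄₁ b) ->
  (idm z ⋄₁ a) ∘ ((idm z ⋄₁ q) ∘ swapm x z L)
  = (idm z ⋄₁ p) ∘ swapm x z M ∘ (idm x ⋄₁ (idm z ⋄₁ b)).
Proof. by move=> e; rewrite compA tensm1M e -tensm1M -!compA swapm_nat. Qed.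

Lemma passm_lastm n (ys : objs X n.+1) x y :
  lastm ys (x ⋄ y) ∘ (passm (ofront ys) x y ⋄₁ idm (olast ys))
  = passm ys x y ∘ (idm x ⋄₁ lastm ys y) ∘ assoc x _ (olast ys).
Proof.
elim: n ys => [|n IH] ys.
  by rewrite passmS /= !tensm1 compm1 comp1m symm_tensl.
rewrite (passmS ys) (passmS (ofront ys)); exact: swapm_consm (IH ys.2).
Qed.

Lemma passm_merge n m (ys : objs X n.+1) x y : (m < n)%N ->
  mergem m ys (x ⋄ y) ∘ passm (omerge m ys) x y
  = passm ys x y ∘ (idm x ⋄₁ mergem m ys y).
Proof.
elim: n m ys => // n IH [|m] ys; rewrite ?ltnS => lt_m.
  (* Merging the first two entries: [x] passes their product at once or one by one, which
     [assoc_swapm] compares. *)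
  rewrite !passmS [mergem _ _ _]/(assoc _ _ _) [mergem _ _ y]/(assoc _ _ _).
  rewrite compA assoc_natr -compA assoc_swapm !compA tensm1M.
  by rewrite -passmS.
rewrite (passmS (omerge m.+1 ys)) (passmS ys).
exact: tens_swapm (IH m ys.2 lt_m).
Qed.

End Cons.

(** * Cutting tuples of arguments *)

Section Splitting.
Variables (R : comPzRingType) (X : symMonCat R) (A : monoidF X).

(* Cutting a tuple of length i + j + 1 after its i-th entry. As [i + j.+1] does *)
(* not reduce to [(i + j).+1], [oleft] and [oright] would need a cast here. *)
Fixpoint oleftS (i j : nat) : objs X (i + j).+1 -> objs X i :=
  match i with
  | 0 => fun _ => tt
  | k.+1 => fun zs => (zs.1, @oleftS k j zs.2)
  end.

Fixpoint orightS (i j : nat) : objs X (i + j).+1 -> objs X j.+1 :=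
  match i with
  | 0 => fun zs => zs
  | k.+1 => fun zs => @orightS k j zs.2
  end.

Fixpoint eleftS (i j : nat) :
    forall zs : objs X (i + j).+1, elts A zs -> elts A (oleftS zs) :=
  match i with
  | 0 => fun _ _ => tt
  | k.+1 => fun zs c => (c.1, @eleftS k j zs.2 c.2)
  end.

Fixpoint erightS (i j : nat) :
    forall zs : objs X (i + j).+1, elts A zs -> elts A (orightS zs) :=
  match i with
  | 0 => fun _ c => c
  | k.+1 => fun zs c => @erightS k j zs.2 c.2
  end.

Fixpoint cupmS (i j : nat) : forall (zs : objs X (i + j).+1) (x y : X),
    hom (tensl (oleftS zs) x ⋄ tensl (orightS zs) y) (tensl zs (x ⋄ y)) :=
  match i with
  | 0 => fun zs x y => passm zs x y
  | k.+1 => fun zs x y => consm zs.1 (@cupmS k j zs.2 x y)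
  end.

(* The lemmas below compare two ways of cutting a tuple together with a *)
(* morphism whose source depends on the cut. The equality is expressed by an *)
(* arbitrary function [K] of all these data, which spares the casts between *)
(* the sources; letting [U] vary makes the induction on i go through. *)
Lemma split_mergel i j m (zs : objs X (i + j).+1) (c : elts A zs) (x y : X)
    (U : X -> Type)
    (K : forall (l : objs X i) (el : elts A l) (r : objs X j) (er : elts A r) T,
      hom (tensl l x ⋄ tensl r y) T -> U T) : (m < i)%N ->
  K _ (eleft (emerge m c)) _ (eright (emerge m c)) _
    (mergem m zs (x ⋄ y) ∘ cupm (omerge m zs) x y)
  = K _ (emerge m (@eleft R X A i.+1 j zs c)) _ (@eright R X A i.+1 j zs c) _
    (@cupm R X i.+1 j zs x y ∘ (mergem m (@oleft R X i.+1 j zs) x ⋄₁ idm _)).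
Proof.
elim: i m zs c U K => // i IH [|m] zs c U K; rewrite ?ltnS => lt_m.
  congr (K _ _ _ _ _ _).
  rewrite [mergem _ _ _]/(assoc _ _ _) [mergem _ _ x]/(assoc _ _ _).
  rewrite [cupm _ _ _]/(consm _ _).
  rewrite [@cupm _ _ i.+2 _ _ _ _]/(consm _ (consm _ _)).
  rewrite /consm compA assoc_natr -compA pentagon -!compA.
  by rewrite (comp_reassoc (tensm1M _ _ _)).
(* The continuation for the tail restores the head and its factor, so its values lie in
   [U (zs.1 ⋄ T)]. *)
have := IH m zs.2 c.2 _ (fun l el r er T h =>
  K (zs.1, l) (c.1, el) r er _ (consm zs.1 h)) lt_m.
by rewrite -tens_consm -consm_tensl.
Qed.

Lemma split_merger i j m (zs : objs X (i + j).+1) (c : elts A zs) (x y : X)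
    (U : X -> Type)
    (K : forall (l : objs X i) (el : elts A l) (r : objs X j) (er : elts A r) T,
      hom (tensl l x ⋄ tensl r y) T -> U T) : (m < j)%N ->
  K _ (eleft (emerge (i + m) c)) _ (eright (emerge (i + m) c)) _
    (mergem (i + m) zs (x ⋄ y) ∘ cupm (omerge (i + m) zs) x y)
  = K _ (eleftS c) _ (emerge m (erightS c)) _
    (cupmS zs x y ∘ (idm _ ⋄₁ mergem m (orightS zs) y)).
Proof.
move=> lt_m; elim: i zs c U K => [|i IH] zs c U K.
  by rewrite passm_merge.
have := IH zs.2 c.2 _ (fun l el r er T h =>
  K (zs.1, l) (c.1, el) r er _ (consm zs.1 h)).
by rewrite -tens_consm -consm_tensr.
Qed.

(** The entry after the first i is either the last one of the left block or the first one of the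
    right block; [K] receives it separately as [a]. *)
Lemma split_middle i j (zs : objs X (i + j).+1) (c : elts A zs) (x y : X)
    (U : X -> Type)
    (K : forall (l : objs X i) (el : elts A l) t (a : A t)
      (r : objs X j) (er : elts A r) T,
      hom ((tensl l x ⋄ t) ⋄ tensl r y) T -> U T) :
  K _ (efront (@eleft R X A i.+1 j zs c)) _ (elast (@eleft R X A i.+1 j zs c))
    _ (@eright R X A i.+1 j zs c) _
    (@cupm R X i.+1 j zs x y ∘ (lastm (@oleft R X i.+1 j zs) x ⋄₁ idm _))
  = K _ (eleftS c) _ (erightS c).1 _ (erightS c).2 _
    (cupmS zs x y ∘ assoc _ _ _).
Proof.
elim: i zs c U K => [|i IH] zs c U K.
  congr (K _ _ _ _ _ _ _ _).
  transitivity (passm zs x y ∘ assoc x zs.1 (tensl zs.2 y)) => //.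
  by rewrite passmS -[RHS]compA swapm_assoc [RHS]compA.
have := IH zs.2 c.2 _ (fun l el t a r er T h =>
  K (zs.1, l) (c.1, el) t a r er _ (consm3 zs.1 h)).
by rewrite -consm_consm -consm_assoc.
Qed.

Lemma split_last i j (zs : objs X (i + j).+1) (c : elts A zs) (x y : X)
    (U : X -> Type)
    (K : forall (l : objs X i) (el : elts A l) (r : objs X j) (er : elts A r)
      t (a : A t) T,
      hom ((tensl l x ⋄ tensl r y) ⋄ t) T -> U T) :
  K _ (eleft (efront c)) _ (eright (efront c)) _ (elast c) _
    (lastm zs (x ⋄ y) ∘ (cupm (ofront zs) x y ⋄₁ idm _))
  = K _ (eleftS c) _ (efront (erightS c)) _ (elast (erightS c)) _
    (cupmS zs x y ∘ (idm _ ⋄₁ lastm (orightS zs) y) ∘ assoc _ _ _).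
Proof.
elim: i zs c U K => [|i IH] zs c U K.
  by rewrite passm_lastm.
have := IH zs.2 c.2 _ (fun l el r er t a T h =>
  K (zs.1, l) (c.1, el) r er t a _ (consm3 zs.1 h)).
by rewrite -consm_consm -consm_assoc -consm_tensr.
Qed.

End Splitting.

(** * Transport along equalities of degrees *)

Section Casts.
Variables (R : comPzRingType) (X : symMonCat R) (A : monoidF X).

(** Values in an arbitrary [U] rather than [A]: fixing the first entry of a tuple then gives again
    an [efamily], for [fun T => U (zs.1 ⋄ T)]. *)
Definition efamily (w : X) (U : X -> Type) (n : nat) :=
  forall zs : objs X n, elts A zs -> U (tensl zs w).

(** Lets a cast pass to the tail, so that inductions on i reach [i = 0], where the cast is trivial
    by uniqueness of equality proofs on [nat]. *)
Lemma ecast_efamilyS w U n m (e : n = m) (e' : n.+1 = m.+1)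
    (F : efamily w U n.+1) (zs : objs X m.+1) (c : elts A zs) :
  ecast k (efamily w U k) e' F zs c
  = ecast k (efamily w (fun T => U (zs.1 ⋄ T)) k) e
      (fun zs' c' => F (zs.1, zs') (c.1, c')) zs.2 c.2.
Proof.
case: _ / e in e' zs c *; rewrite (eq_irrelevance e' erefl).
by case: zs c => ? ? [].
Qed.

Lemma eq_ecast_efamily w U n m (e : n = m) (F G : efamily w U n)
    (zs : objs X m) (c : elts A zs) :
  (forall zs' (c' : elts A zs'), F zs' c' = G zs' c') ->
  ecast k (efamily w U k) e F zs c = ecast k (efamily w U k) e G zs c.
Proof. by case: _ / e in zs c *. Qed.

Lemma ecast_split i j (e : (i + j.+1)%N = (i + j).+1)
    (zs : objs X (i + j).+1) (c : elts A zs) (x y : X) (U : X -> Type)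
    (K : forall (l : objs X i) (el : elts A l) (r : objs X j.+1)
      (er : elts A r) T, hom (tensl l x ⋄ tensl r y) T -> U T) :
  ecast n (efamily (x ⋄ y) U n) e
    (fun zs c => K _ (eleft c) _ (eright c) _ (cupm zs x y)) zs c
  = K _ (eleftS c) _ (erightS c) _ (cupmS zs x y).
Proof.
elim: i e zs c U K => [|i IH] e zs c U K.
  by rewrite (eq_irrelevance e erefl).
have e1 : (i + j.+1)%N = (i + j).+1 by rewrite addnS.
rewrite (ecast_efamilyS e1); exact: (IH e1 zs.2 c.2 _ (fun l el r er T h =>
  K (zs.1, l) (c.1, el) r er _ (consm zs.1 h))).
Qed.

(** The coherence behind associativity when the first cochain has degree 0; it starts the induction
    of [ecast_split3]. *)
Lemma passm_cupm j k (zs : objs X (j + k)%N) x y z :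
  tenslm (homs1 zs) (assoc x y z) ∘ cupm zs (x ⋄ y) z
    ∘ (passm (oleft zs) x y ⋄₁ idm (tensl (oright zs) z))
  = passm zs x (y ⋄ z) ∘ (idm x ⋄₁ cupm zs y z)
    ∘ assoc x (tensl (oleft zs) y) (tensl (oright zs) z).
Proof.
elim: j zs => [|j IH] zs.
  by rewrite [passm (oleft _) _ _]/= tensm1 compm1 -passm_tens.
rewrite [passm (oleft zs) x y]passmS.
rewrite [passm zs x _]passmS.
rewrite [tenslm _ _]/(idm zs.1 ⋄₁ tenslm (homs1 zs.2) _).
rewrite [cupm zs (x ⋄ y) z]/(consm zs.1 _) [cupm zs y z]/(consm zs.1 _).
by rewrite tens_consm; apply: swapm_consm (IH zs.2).
Qed.

Lemma ecast_split3 i j k (e : (i + (j + k))%N = (i + j + k)%N)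
    (zs : objs X (i + j + k)%N) (c : elts A zs) (x y z : X) (U : X -> Type)
    (K : forall (l : objs X i) (el : elts A l) (m : objs X j) (em : elts A m)
      (r : objs X k) (er : elts A r) T,
      hom ((tensl l x ⋄ tensl m y) ⋄ tensl r z) T -> U T) :
  K _ (eleft (eleft c)) _ (eright (eleft c)) _ (eright c) _
    (tenslm (homs1 zs) (assoc x y z) ∘ cupm zs (x ⋄ y) z
      ∘ (cupm (oleft zs) x y ⋄₁ idm _))
  = ecast n (efamily (x ⋄ (y ⋄ z)) U n) e
      (fun zs c => K _ (eleft c) _ (eleft (eright c)) _ (eright (eright c)) _
        (cupm zs x (y ⋄ z) ∘ (idm _ ⋄₁ cupm (oright zs) y z) ∘ assoc _ _ _))
      zs c.
Proof.
elim: i e zs c U K => [|i IH] e zs c U K.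
  by rewrite (eq_irrelevance e erefl) passm_cupm.
have e1 : (i + (j + k))%N = (i + j + k)%N by rewrite addnA.
rewrite (ecast_efamilyS e1).
have := IH e1 zs.2 c.2 _ (fun l el m em r er T h =>
  K (zs.1, l) (c.1, el) m em r er _ (consm3 zs.1 h)).
rewrite -consm_consm -tens_consm => ->.
apply: eq_ecast_efamily => zs' c'.
by rewrite -consm_assoc -consm_tensr.
Qed.

Lemma ecast_split_runit i (e : (i + 0)%N = i)
    (zs : objs X i) (c : elts A zs) (x : X) (U : X -> Type)
    (K : forall (l : objs X i) (el : elts A l) T,
      hom (tensl l x ⋄ one) T -> U T) :
  ecast n (efamily x U n) e
    (fun zs c => K _ (eleft c) _
       (tenslm (homs1 zs) (runit x) ∘ cupm zs x one)) zs c
  = K _ c _ (runit (tensl zs x)).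
Proof.
elim: i e zs c U K => [|i IH] e zs c U K.
  rewrite (eq_irrelevance e erefl) /= compm1.
  by case: zs c => -[].
have e1 : (i + 0)%N = i by rewrite addn0.
rewrite (ecast_efamilyS e1) /=.
have := IH e1 zs.2 c.2 _ (fun l el T h =>
  K (zs.1, l) (c.1, el) _ (consm zs.1 h)).
rewrite {2}/consm runit_assoc; case: zs c => z zs [a c] /= <-.
apply: eq_ecast_efamily => zs' c'.
by rewrite -tens_consm.
Qed.

End Casts.

(** * The cup product of cochains *)

Section CupProduct.
Variables (R : comPzRingType) (X : symMonCat R) (A : monoidF X).

HB.instance Definition _ x y (a : A x) :=
  GRing.isLinear.Build R (A y) (A (x ⋄ y)) *:%R (mmul A a)
    (@mmul_linr R X A x y a).

Definition mmulr x y (b : A y) (a : A x) := mmul A a b.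

HB.instance Definition _ x y (b : A y) :=
  GRing.isLinear.Build R (A x) (A (x ⋄ y)) *:%R (@mmulr x y b)
    (@mmul_linl R X A x y b).

Lemma mmul_fmapl x x' y (h : hom x x') (a : A x) (b : A y) :
  mmul A (fmap A h a) b = fmap A (h ⋄₁ idm y) (mmul A a b).
Proof. by rewrite -mmul_nat fmap1. Qed.

Lemma mmul_fmapr x y y' (h : hom y y') (a : A x) (b : A y) :
  mmul A a (fmap A h b) = fmap A (idm x ⋄₁ h) (mmul A a b).
Proof. by rewrite -mmul_nat fmap1. Qed.

Lemma cfun_ecast x n m (e : n = m) (f : cochain A n x) (zs : objs X m)
    (c : elts A zs) :
  (ecast k (cochain A k x) e f) zs c
  = ecast k (efamily A x (fun T => A T) k) e (@cfun R X A n x f) zs c.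
Proof. by case: _ / e in zs c *. Qed.

Lemma ecast_cupE i j x y (f : cochain A i x) (g : cochain A j.+1 y)
    (e : (i + j.+1)%N = (i + j).+1) zs (c : elts A zs) :
  (ecast n (cochain A n (x ⋄ y)) e (f ⌣ g)) zs c
  = fmap A (cupmS zs x y)
      (mmul A (f (oleftS zs) (eleftS c)) (g (orightS zs) (erightS c))).
Proof.
rewrite cfun_ecast.
exact: (@ecast_split _ _ _ _ _ e zs c x y (fun T => A T) (fun l el r er T h =>
  fmap A h (mmul A (f l el) (g r er)))).
Qed.

Lemma betaE n x (f : cochain A n x) (xs : objs X n.+1) (a : elts A xs) :
  beta f xs a = mmul A a.1 (f xs.2 a.2)
  + \sum_(m < n) (-1) ^+ m.+1 *:
      fmap A (mergem m xs x) (f (omerge m xs) (emerge m a))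
  + (-1) ^+ n.+1 *:
      fmap A (lastm xs x) (mmul A (f (ofront xs) (efront a)) (elast a)).
Proof. by []. Qed.

Lemma cupE i j x y (f : cochain A i x) (g : cochain A j y)
    (zs : objs X (i + j)%N) (c : elts A zs) :
  (f ⌣ g) zs c = fmap A (cupm zs x y)
    (mmul A (f (oleft zs) (eleft c)) (g (oright zs) (eright c))).
Proof. by []. Qed.

Section Terms.
Variables (i j : nat) (x y : X) (f : cochain A i x) (g : cochain A j y).
Variables (zs : objs X (i + j).+1) (c : elts A zs).
(** As [(i + j).+1] is convertible to [i.+1 + j], the cut belonging to [beta f ⌣ g] needs no cast,
    unlike that of [f ⌣ beta g]. *)
Let l := @oleft R X i.+1 j zs.
Let r := @oright R X i.+1 j zs.
Let el : elts A l := @eleft R X A i.+1 j zs c.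
Let er : elts A r := @eright R X A i.+1 j zs c.

Lemma mmul_cup :
  mmul A c.1 ((f ⌣ g) zs.2 c.2)
  = fmap A (@cupm R X i.+1 j zs x y)
      (mmul A (mmul A el.1 (f l.2 el.2)) (g r er)).
Proof. by rewrite cupE mmul_fmapr -mmulA -fmapM. Qed.

Lemma cup_mergel m : (m < i)%N ->
  fmap A (mergem m zs (x ⋄ y)) ((f ⌣ g) (omerge m zs) (emerge m c))
  = fmap A (@cupm R X i.+1 j zs x y)
      (mmul A (fmap A (mergem m l x) (f (omerge m l) (emerge m el))) (g r er)).
Proof.
move=> lt_m; rewrite cupE mmul_fmapl -!fmapM.
exact: (@split_mergel R X A i j m zs c x y (fun T => A T)
  (fun l el r er T h => fmap A h (mmul A (f l el) (g r er)))).
Qed.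

Lemma cup_merger m : (m < j)%N ->
  fmap A (mergem (i + m) zs (x ⋄ y))
    ((f ⌣ g) (omerge (i + m) zs) (emerge (i + m) c))
  = fmap A (cupmS zs x y) (mmul A (f (oleftS zs) (eleftS c))
      (fmap A (mergem m (orightS zs) y)
        (g (omerge m (orightS zs)) (emerge m (erightS c))))).
Proof.
move=> lt_m; rewrite cupE mmul_fmapr -!fmapM.
exact: (@split_merger R X A i j m zs c x y (fun T => A T)
  (fun l el r er T h => fmap A h (mmul A (f l el) (g r er)))).
Qed.

(** The left side comes from the last face of [f], the right side from the first face of [g]: the
    pair that cancels in [beta_cup]. *)
Lemma cup_middle :
  fmap A (@cupm R X i.+1 j zs x y)
    (mmul A (fmap A (lastm l x) (mmul A (f (ofront l) (efront el)) (elast el)))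
      (g r er))
  = fmap A (cupmS zs x y) (mmul A (f (oleftS zs) (eleftS c))
      (mmul A (erightS c).1 (g (orightS zs).2 (erightS c).2))).
Proof.
rewrite mmul_fmapl -mmulA -!fmapM.
exact: (@split_middle R X A i j zs c x y (fun T => A T)
  (fun l el t a r er T h => fmap A h (mmul A (mmul A (f l el) a) (g r er)))).
Qed.

Lemma cup_last :
  fmap A (lastm zs (x ⋄ y)) (mmul A ((f ⌣ g) (ofront zs) (efront c)) (elast c))
  = fmap A (cupmS zs x y) (mmul A (f (oleftS zs) (eleftS c))
      (fmap A (lastm (orightS zs) y)
        (mmul A (g (ofront (orightS zs)) (efront (erightS c)))
          (elast (erightS c))))).
Proof.
rewrite cupE mmul_fmapl mmul_fmapr -mmulA -!fmapM.
exact: (@split_last R X A i j zs c x y (fun T => A T)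
  (fun l el r er t a T h => fmap A h (mmul A (mmul A (f l el) (g r er)) a))).
Qed.

End Terms.

Lemma beta_cup i j x y (f : cochain A i x) (g : cochain A j y) :
  beta (f ⌣ g)
  = beta f ⌣ g
    + (-1) ^+ i *:
        ecast n (cochain A n (x ⋄ y)) (addnS i j) (f ⌣ beta g).
Proof.
apply: cochainP => zs c.
transitivity ((beta f ⌣ g) zs c + (-1) ^+ i *:
  (ecast n (cochain A n (x ⋄ y)) (addnS i j) (f ⌣ beta g)) zs c); last by [].
rewrite ecast_cupE (cupE (beta f)) !betaE big_split_ord mmul_cup cup_last.
under eq_bigr => m _ do rewrite (cup_mergel f g c (ltn_ord m)).
under [X in _ + (_ + X) + _]eq_bigr => m _ do
  rewrite (cup_merger f g c (ltn_ord m)).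
rewrite -[mmul A (_ + _) _]/(mmulr _ _) !linearD !linear_sum /=.
rewrite [mmulr _ (_ *: _)]linearZ /= !linearZ /= /mmulr cup_middle.
(* The two middle terms carry the signs $(-1)^{i+1}$ and $(-1)^i$ and cancel. *)
rewrite -!addrA [(-1) ^+ i.+1]exprS mulN1r scaleNr addKr.
congr (_ + (_ + (_ + _))).
- apply: eq_bigr => m _.
  by rewrite -[mmul A (_ *: _) _]/(mmulr _ _) !linearZ.
- apply: eq_bigr => m _; rewrite !linearZ /= scalerA -exprD addSn.
  by congr (_ ^+ _.+1 *: _); exact: addnC.
- by rewrite !scalerA -exprD addSn; congr (_ ^+ _.+1 *: _); exact: addnC.
Qed.

Lemma cup_linl i j x y (g : cochain A j y) :
  linear (fun f : cochain A i x => f ⌣ g).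
Proof.
move=> k f f'; apply: cochainP => zs c.
by rewrite cochainZDE !cupE cochainZDE mmul_linl linearP.
Qed.

Lemma cup_linr i j x y (f : cochain A i x) :
  linear (fun g : cochain A j y => f ⌣ g).
Proof.
move=> k g g'; apply: cochainP => zs c.
by rewrite cochainZDE !cupE cochainZDE !linearP.
Qed.

HB.instance Definition _ i j x y (f : cochain A i x) :=
  GRing.isLinear.Build R (cochain A j y) (cochain A (i + j)%N (x ⋄ y)) *:%R
    (@cup R X A i j x y f) (@cup_linr i j x y f).

Definition cupr i j x y (g : cochain A j y) (f : cochain A i x) := f ⌣ g.

HB.instance Definition _ i j x y (g : cochain A j y) :=
  GRing.isLinear.Build R (cochain A i x) (cochain A (i + j)%N (x ⋄ y)) *:%R
    (@cupr i j x y g) (@cup_linl i j x y g).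

Lemma cup0l i j x y (g : cochain A j y) : (0 : cochain A i x) ⌣ g = 0.
Proof. exact: (linear0 (cupr g)). Qed.

Lemma cup_nat i j x x' y y' (phi : hom x x') (psi : hom y y')
    (f : cochain A i x) (g : cochain A j y) :
  cmap phi f ⌣ cmap psi g = cmap (phi ⋄₁ psi) (f ⌣ g).
Proof.
have hl (zs : objs X (i + j)%N) : hleft (homs1 zs) = homs1 (oleft zs).
  by elim: i zs {f} => //= k IH zs; congr pair; apply: (IH zs.2).
have hr (zs : objs X (i + j)%N) : hright (homs1 zs) = homs1 (oright zs).
  by elim: i zs {f hl} => //= k IH zs; apply: (IH zs.2).
apply: cochainP => zs c; rewrite /= mmul_nat -!fmapM.
by have := cupm_nat (homs1 zs) phi psi; rewrite hl hr => ->.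
Qed.

Lemma cupA i j k x y z (f : cochain A i x) (g : cochain A j y)
    (h : cochain A k z) :
  cmap (assoc x y z) ((f ⌣ g) ⌣ h)
  = ecast n (cochain A n (x ⋄ (y ⋄ z))) (addnA i j k) (f ⌣ (g ⌣ h)).
Proof.
apply: cochainP => zs c; rewrite cfun_ecast.
rewrite [LHS]/= mmul_fmapl -!fmapM.
rewrite (@ecast_split3 R X A i j k (addnA i j k) zs c x y z (fun T => A T)
  (fun l el m em r er T u =>
     fmap A u (mmul A (mmul A (f l el) (g m em)) (h r er)))).
apply: eq_ecast_efamily => zs' c'.
by rewrite cupE mmul_fmapr -mmulA -!fmapM.
Qed.

Lemma cup1l i x (f : cochain A i x) :
  cmap (lunit x) (cochain0 (mone A) ⌣ f) = f.
Proof.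
apply: cochainP => zs c.
transitivity (fmap A (tenslm (homs1 zs) (lunit x) ∘ passm zs one x)
  (mmul A (mone A) (f zs c))); first by rewrite fmapM.
by rewrite lunit_passm mmul1l.
Qed.

Lemma cup1r i x (f : cochain A i x) :
  ecast n (cochain A n x) (addn0 i) (cmap (runit x) (f ⌣ cochain0 (mone A)))
  = f.
Proof.
apply: cochainP => zs c; rewrite cfun_ecast -[RHS]mmul1r.
rewrite -(@ecast_split_runit R X A i (addn0 i) zs c x (fun T => A T)
  (fun l el T u => fmap A u (mmul A (f l el) (mone A)))).
by apply: eq_ecast_efamily => zs' c' /=; rewrite fmapM.
Qed.

(** Both sides are the image of [a] under [runitV y], because [runit y ∘ symm one y] is
    [lunit y]. *)
Lemma mone_commutant : commutant (mone A).
Proof.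
move=> y a; rewrite -[LHS]fmap1 -(runitK y) fmapM mmul1r.
by rewrite -{1}(mmul1l a) -fmapM -runit_symm compA runitK comp1m.
Qed.
End CupProduct.

(** * The cup product on cohomology *)

Section CohomologyCasts.
Variables (R : comPzRingType) (X : symMonCat R) (C : cochainSeq X).

Lemma is_cobound_ecast n m (e : n = m) x (f : C n x) :
  is_cobound (ecast k (C k x) e f) -> is_cobound f.
Proof. by case: _ / e. Qed.

Lemma cls_ecast n m (e : n = m) x (f : cocycle C n x) :
  ecast k (cohomF C k x) e (cls f) = cls (ecast k (cocycle C k x) e f).
Proof. by case: _ / e. Qed.

Lemma cval_ecast n m (e : n = m) x (f : cocycle C n x) :
  cval (ecast k (cocycle C k x) e f) = ecast k (C k x) e (cval f).
Proof. by case: _ / e. Qed.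

End CohomologyCasts.

Section CupHH.
Variables (R : comPzRingType) (X : symMonCat R) (A : monoidF X).
Let C := hochschild A.

Lemma ecast_cochain0 n m (e : n = m) x :
  ecast k (cochain A k x) e (0 : cochain A n x) = 0.
Proof. by case: _ / e. Qed.

Lemma cup_cocycle i j x y (f : cochain A i x) (g : cochain A j y) :
  beta f = 0 -> beta g = 0 -> beta (f ⌣ g) = 0.
Proof.
move=> f0 g0; rewrite beta_cup f0 g0 cup0l linear0 ecast_cochain0.
by rewrite scaler0 addr0.
Qed.

(** If [f] is [beta h], the Leibniz rule gives [f ⌣ g = beta (h ⌣ g)]; in degree 0 a coboundary is
    0. *)
Lemma cup_coboundl i j x y (f : C i x) (g : cochain A j y) :
  is_cobound f -> beta g = 0 -> is_cobound (f ⌣ g : C (i + j)%N (x ⋄ y)).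
Proof.
case: i f => [|i] f fB g0.
  by rewrite [f]fB cup0l; exact: is_cobound0.
case: fB => h ->; exists (h ⌣ g).
rewrite [RHS]beta_cup g0 linear0 ecast_cochain0.
by rewrite scaler0 addr0.
Qed.

Lemma cup_coboundr i j x y (f : cochain A i x) (g : C j y) :
  beta f = 0 -> is_cobound g -> is_cobound (f ⌣ g : C (i + j)%N (x ⋄ y)).
Proof.
case: j g => [|j] g f0.
  by move=> ->; rewrite linear0; exact: is_cobound0.
case=> h ->; apply: (@is_cobound_ecast R X C _ _ (addnS i j) _ (f ⌣ beta h)).
(* The Leibniz rule gives [f ⌣ beta h] the sign $(-1)^i$; this factor squares it to 1. *)
exists ((-1) ^+ i *: (f ⌣ h)).
rewrite linearZ /= beta_cup f0 cup0l add0r scalerA -exprD addnn -mul2n exprM.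
by rewrite sqrrN expr1n expr1n scale1r.
Qed.

Lemma beta_cocycle n x (f : cocycle C n x) : beta (cval f) = 0.
Proof. exact: (eqP (cvalP f)). Qed.

Definition cup_cocycles i j x y (f : cocycle C i x) (g : cocycle C j y) :
    cocycle C (i + j)%N (x ⋄ y) :=
  @Cocycle R X C (i + j)%N (x ⋄ y) (cval f ⌣ cval g)
    (introT eqP (cup_cocycle (beta_cocycle f) (beta_cocycle g))).

Definition cohom_repr n x (u : HH A n x) : cocycle C n x :=
  repr (u : {ideal_quot @coboundp R X C n x})%qT.

Lemma cohom_reprK n x (u : HH A n x) : cls (cohom_repr u) = u.
Proof. by rewrite /cls reprK. Qed.

Definition HHcup i j x y (u : HH A i x) (v : HH A j y) : HH A (i + j) (x ⋄ y) :=
  cls (cup_cocycles (cohom_repr u) (cohom_repr v)).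

(** Independence of the representatives chosen in [HHcup]. All laws on classes reduce through it to
    laws on cochains. *)
Lemma HHcup_cls i j x y (f : cocycle C i x) (g : cocycle C j y) :
  HHcup (cls f : HH A i x) (cls g : HH A j y) = cls (cup_cocycles f g).
Proof.
apply/cls_eq.
set f' := cohom_repr _; set g' := cohom_repr _.
have fB : is_cobound (cval f' - cval f) by apply/cls_eq; exact: cohom_reprK.
have gB : is_cobound (cval g' - cval g) by apply/cls_eq; exact: cohom_reprK.
(* Each summand has a coboundary as one factor; the scalar 1 only matches the form of
   [is_coboundZD]. *)
have -> : cval (cup_cocycles f' g') - cval (cup_cocycles f g)
    = 1 *: (cupr (cval g') (cval f' - cval f)) + (cval f ⌣ (cval g' - cval g)).
  by rewrite scale1r !linearB addrA subrK.
apply: is_coboundZD.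
  exact: cup_coboundl fB (beta_cocycle g').
exact: cup_coboundr (beta_cocycle f) gB.
Qed.

Lemma HHcup_linl i j x y (v : HH A j y) :
  linear (fun u : HH A i x => HHcup u v).
Proof.
move=> k u u'.
case: (cls_surj u) (cls_surj u') (cls_surj v) => f -> [f' ->] [g ->].
rewrite -clsZD !HHcup_cls -clsZD; congr cls; apply: val_inj.
exact: cup_linl.
Qed.

Lemma HHcup_linr i j x y (u : HH A i x) :
  linear (fun v : HH A j y => HHcup u v).
Proof.
move=> k v v'.
case: (cls_surj u) (cls_surj v) (cls_surj v') => f -> [g ->] [g' ->].
rewrite -clsZD !HHcup_cls -clsZD; congr cls; apply: val_inj.
exact: cup_linr.
Qed.

Lemma HHcup_nat i j x x' y y' (phi : hom x x') (psi : hom y y')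
    (u : HH A i x) (v : HH A j y) :
  HHcup (fmap (HH A i) phi u) (fmap (HH A j) psi v)
  = fmap (HH A (i + j)%N) (phi ⋄₁ psi) (HHcup u v).
Proof.
case: (cls_surj u) (cls_surj v) => f -> [g ->].
rewrite [fmap _ phi _]hmap_cls [fmap _ psi _]hmap_cls !HHcup_cls [RHS]hmap_cls.
congr cls; apply: val_inj.
exact: cup_nat.
Qed.

Lemma HHcupA i j k x y z (u : HH A i x) (v : HH A j y) (w : HH A k z) :
  fmap (HH A (i + j + k)%N) (assoc x y z) (HHcup (HHcup u v) w)
  = ecast n (HH A n (x ⋄ (y ⋄ z))) (addnA i j k) (HHcup u (HHcup v w)).
Proof.
case: (cls_surj u) (cls_surj v) (cls_surj w) => f -> [g ->] [h ->].
rewrite (HHcup_cls f g) (HHcup_cls _ h) (HHcup_cls g h) (HHcup_cls f).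
rewrite [LHS]hmap_cls cls_ecast; congr cls; apply: val_inj.
rewrite [RHS]cval_ecast. exact: cupA.
Qed.

Definition HHone : HH A 0 one := CA_HH0 (@mone_commutant R X A).

Lemma HHcup1l i x (u : HH A i x) :
  fmap (HH A (0 + i)%N) (lunit x) (HHcup HHone u) = u.
Proof.
case: (cls_surj u) => f ->.
rewrite HHcup_cls /= hmap_cls; congr cls; apply: val_inj; exact: cup1l.
Qed.

Lemma HHcup1r i x (u : HH A i x) :
  ecast n (HH A n x) (addn0 i) (fmap (HH A (i + 0)%N) (runit x) (HHcup u HHone))
  = u.
Proof.
case: (cls_surj u) => f ->.
rewrite HHcup_cls /= hmap_cls cls_ecast; congr cls; apply: val_inj.
rewrite [LHS]cval_ecast; exact: cup1r.
Qed.

Definition HHgraded : gradedMonoid (HH A) :=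
  GradedMonoid HHcup_linl HHcup_linr HHcup_nat HHcupA HHcup1l HHcup1r.

End CupHH.

Theorem mainTheorem6 (R : comPzRingType) (X : symMonCat R) (A : monoidF X) :
  (forall (i j : nat) (x y : X) (f : cochain A i x) (g : cochain A j y),
     beta (f ⌣ g)
     = beta f ⌣ g
       + (-1) ^+ i *:
           ecast n (cochain A n (x ⋄ y)) (addnS i j) (f ⌣ beta g))
  /\
  (exists G : gradedMonoid (HH A),
     (forall (i j : nat) (x y : X) (f : cochain A i x) (g : cochain A j y)
        (hf : beta f = 0) (hg : beta g = 0),
        exists hfg : beta (f ⌣ g) = 0,
          gmul G (HHclass hf) (HHclass hg) = HHclass hfg)
     /\
     (exists hε : commutant (mone A), gone G = CA_HH0 hε)).
Proof.
split; first exact: beta_cup.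
exists (HHgraded A); split; last by exists (@mone_commutant R X A).
move=> i j x y f g hf hg; exists (cup_cocycle hf hg).
(* The two cocycles have the same underlying cochain and can differ only in the proof of
   closedness. *)
by rewrite [LHS]HHcup_cls; congr cls; apply: val_inj.
Qed.
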